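(* Let $\mathbb{Y}$ be the Young graph and, for $n\ge 1$, let $\mathbb{Y}_n$ be the graph consisting of its levels up to $n$. Then: (a) The Young graph $\mathbb{Y}$ is the branching graph of the symmetric groups, i.e. there is an isomorphism of graded graphs between $\mathbb{Y}$ and the branching graph of the chain $S_0\subset S_1\subset S_2\subset\cdots$. (b) For every $n\ge 1$, the spectrum of the Gelfand--Tsetlin algebra $GZ(n)$ is the space of paths in $\mathbb{Y}_n$ (from $\varnothing$ to level $n$), i.e. the set of standard Young tableaux with $n$ boxes; and $\mathrm{Spec}(n)=\mathrm{Cont}(n)$ as subsets of $\mathbb{C}^n$, where $\mathrm{Spec}(n)$ is the spectrum of $GZ(n)$ with respect to the generators $X_1,\dots,X_n$ and $\mathrm{Cont}(n)$ is the set of content vectors of length $n$. (A tableau corresponds to the vector of contents of its boxes.) (c) The equivalence relations $\sim$ and $\approx$ on $\mathrm{Spec}(n)=\mathrm{Cont}(n)$ coincide.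
   Context: All representations are finite-dimensional over $\mathbb{C}$. $S_{n-1}\subset S_n$ is the stabilizer of $n$ ($S_0=\{1\}$). $S_n^\wedge$ is the set of isomorphism classes of irreducible representations of $S_n$. The branching graph has vertex set $\bigsqcup_{n\ge0}S_n^\wedge$ (level $n$ is $S_n^\wedge$), with $\dim\mathrm{Hom}_{S_{n-1}}(V^\mu,V^\lambda)$ directed edges from $\mu\in S_{n-1}^\wedge$ to $\lambda\in S_n^\wedge$; it is known that these numbers are $0$ or $1$. The Young graph $\mathbb{Y}$ has the Young diagrams as vertices (level $n$: diagrams with $n$ boxes), with a single directed edge $\nu\to\eta$ iff $\nu\subset\eta$ and $\eta/\nu$ is a single box. A standard Young tableau with $n$ boxes is a path $\varnothing=\nu_0\to\nu_1\to\cdots\to\nu_n$ in $\mathbb{Y}$. The content of a box is its column index minus its row index; the tableau is assigned the vector $(c(\nu_1/\nu_0),\dots,c(\nu_n/\nu_{n-1}))$. $GZ(n)\subset\mathbb{C}[S_n]$ is the (commutative) subalgebra generated by the centers $Z(i)$ of $\mathbb{C}[S_i]$, $i=1,\dots,n$. The Young--Jucys--Murphy elements are $X_i=(1\,i)+(2\,i)+\dots+(i-1\ i)\in GZ(n)$, $i=1,\dots,n$ ($X_1=0$); they generate $GZ(n)$. For each irreducible $V^\lambda$ of $S_n$, iterating the canonical multiplicity-free decompositions on restriction $S_n\downarrow S_{n-1}\downarrow\cdots\downarrow S_0$ gives a decomposition of $V^\lambda$ into lines indexed by paths from level $0$ to $\lambda$ in the branching graph; choosing a nonzero vector in each line gives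 the Young basis (unique up to scalars). It is a common eigenbasis of the $X_i$. For a Young basis vector $v$ let $\alpha(v)=(a_1,\dots,a_n)$, where $X_iv=a_iv$; $\mathrm{Spec}(n)$ is the set of all $\alpha(v)$, $v$ ranging over the Young bases of all irreducible representations of $S_n$. Each $\alpha\in\mathrm{Spec}(n)$ determines $v=v_\alpha$ up to scalar. Write $\alpha\sim\beta$ if $v_\alpha,v_\beta$ lie in the same irreducible $S_n$-module. $\mathrm{Cont}(n)$ is the set of $(a_1,\dots,a_n)\in\mathbb{C}^n$ such that: (1) $a_1=0$; (2) $\{a_q-1,a_q+1\}\cap\{a_1,\dots,a_{q-1}\}\neq\varnothing$ for all $q>1$; (3) if $a_p=a_q=a$ with $p<q$, then $\{a-1,a+1\}\subset\{a_{p+1},\dots,a_{q-1}\}$. An admissible transposition of a vector $(a_1,\dots,a_n)$ is the exchange of adjacent entries $a_i,a_{i+1}$ when $a_{i+1}\ne a_i\pm1$. Write $\alpha\approx\beta$ if $\beta$ is obtained from $\alpha$ by a finite sequence of admissible transpositions. *)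

(* Defs.v *)
From HB Require Import structures.
From mathcomp Require Import all_boot all_order all_algebra all_fingroup.
From mathcomp Require Import generic_quotient mxrepresentation.
From mathcomp Require Import finmap.
From mathcomp Require Import boolp classical_sets functions.
From Stdlib Require Import Relation_Operators.

Set Implicit Arguments.
Unset Strict Implicit.
Unset Printing Implicit Defensive.

Import GRing.Theory.
Local Open Scope ring_scope.
Local Open Scope quotient_scope.

(** * Graded graphs: edges only go from a level to the next one, and are given
    by their multiplicities. *)

Record gradedGraph := GradedGraph {
  vertex :> nat -> Type;
  edges : forall n, vertex n -> vertex n.+1 -> nat }.

Definition graded_iso (G H : gradedGraph) (f : forall n, G n -> H n) : Prop :=
  (forall n, bijective (f n)) /\
  (forall n (mu : G n) (la : G n.+1), edges (f n mu) (f n.+1 la) = edges mu la).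

Definition edge_src n (i : 'I_n) : 'I_n.+1 := widen_ord (leqnSn n) i.
(* Unlike [lift ord0 i], this has value syntactically [i.+1]. *)
Definition edge_tgt n (i : 'I_n) : 'I_n.+1 := @Ordinal n.+1 i.+1 (ltn_ord i).

(* Paths from level 0 to level n, given by their vertices: this is the space of
   paths only when no edge is multiple, as is the case in the two graphs below. *)
Record gpath (G : gradedGraph) (n : nat) := GPath {
  gpath_vertex :> forall i : 'I_n.+1, G i;
  _ : forall i : 'I_n,
    (0 < edges (gpath_vertex (edge_src i)) (gpath_vertex (edge_tgt i)))%N }.

(** * The Young graph *)

(* The box (i, j) is in row i and column j, both counted from 0. *)
Definition is_diagram (D : {fset nat * nat}) : Prop :=
  forall i j i' j' : nat,
    (i, j) \in D -> (i' <= i)%N -> (j' <= j)%N -> (i', j') \in D.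

Record diagram (n : nat) := Diagram {
  boxes :> {fset nat * nat};
  _ : `[< is_diagram boxes >] && (#|` boxes| == n) }.

Definition young_graph : gradedGraph :=
  @GradedGraph diagram
    (fun n nu eta => nat_of_bool ((nu `<=` eta)%fset && (#|` (eta `\` nu)%fset| == 1%N))).

Definition content (b : nat * nat) : int := b.2%:Z - b.1%:Z.

(* The box of eta / nu, when there is exactly one. *)
Definition skew_box (nu eta : {fset nat * nat}) : nat * nat :=
  head (0, 0)%N (enum_fset (eta `\` nu)%fset).

Definition content_vector (F : fieldType) n (T : gpath young_graph n) :
    {ffun 'I_n -> F} :=
  [ffun i => (content (skew_box (T (edge_src i)) (T (edge_tgt i))))%:~R].

(** * The branching graph *)

Record irrep (F : fieldType) (n : nat) := Irrep {
  irrep_dim : nat;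
  irrep_repr :> mx_representation F [set: 'S_n]%G irrep_dim;
  _ : mx_irreducible irrep_repr }.

HB.instance Definition _ F n := gen_eqMixin (irrep F n).
HB.instance Definition _ F n := gen_choiceMixin (irrep F n).

Definition irrep_iso F n : rel (irrep F n) := fun V W => `[< mx_rsim V W >].

Lemma irrep_iso_refl F n : reflexive (@irrep_iso F n).
Proof. by move=> V; apply/asboolP; exact: mx_rsim_refl. Qed.

Lemma irrep_iso_sym F n : symmetric (@irrep_iso F n).
Proof.
by move=> V W; apply/asboolP/asboolP => sim_VW; exact: mx_rsim_sym sim_VW.
Qed.

Lemma irrep_iso_trans F n : transitive (@irrep_iso F n).
Proof.
move=> V U W /asboolP simUV /asboolP simVW; apply/asboolP.
exact: mx_rsim_trans simUV simVW.
Qed.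

Canonical irrep_iso_equiv F n :=
  EquivRel (@irrep_iso F n)
    (@irrep_iso_refl F n) (@irrep_iso_sym F n) (@irrep_iso_trans F n).

Definition irrep_class (F : fieldType) (n : nat) : Type :=
  {eq_quot (@irrep_iso F n)}.

(* V^la, a chosen irreducible representation in the class la *)
Definition class_repr F n (la : irrep_class F n) : irrep F n :=
  repr (la : {eq_quot (@irrep_iso F n)}).

Notation class_dim la := (irrep_dim (class_repr la)).

(* Matrices act on row vectors on the right. As the product s * t of 'S_n is
   "s, then t", a mx_representation is a left representation for the usual
   composition of permutations.  The embedding of 'S_n in 'S_n.+1 as the
   stabilizer of the last point is lift_perm ord_max ord_max. *)
Definition restr_hom F n (V : irrep F n) (W : irrep F n.+1) :
    {vspace 'M[F]_(irrep_dim V, irrep_dim W)} :=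
  (\bigcap_(g : 'S_n) lker (linfun (mulmx (V g)) -
     linfun (mulmxr (W (lift_perm ord_max ord_max g)))))%VS.

Definition branching_graph (F : fieldType) : gradedGraph :=
  @GradedGraph (irrep_class F)
    (fun n mu la => \dim (restr_hom (class_repr mu) (class_repr la))).

(* v spans the line of V^la attached to the path P (ending at la): the summand of
   type mu of the restriction of V^la is the image of any nonzero S_n-map from
   V^mu to V^la, so the line of P is the image of V^(P 0) under the composition of
   such maps along P. *)
Definition young_vector F n (P : gpath (branching_graph F) n)
    (v : 'rV[F]_(class_dim (P ord_max : irrep_class F n))) : Prop :=
  exists w : forall i : 'I_n.+1, 'rV[F]_(class_dim (P i : irrep_class F i)),
    [/\ w ord0 != 0, w ord_max = v &
        forall i : 'I_n, exists B : 'M[F]_(_, _),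
          [/\ B \in restr_hom
                      (class_repr (P (edge_src i) : irrep_class F i))
                      (class_repr (P (edge_tgt i) : irrep_class F i.+1)),
              B != 0 &
              w (edge_tgt i) = w (edge_src i) *m B]].

Arguments young_vector {F n} P v.

(** * The Gelfand-Tsetlin algebra; elements of F['S_n] are the matrices in the
    span [group_ring F [set: 'S_n]] of the regular representation. *)

(* S_i, as the subgroup of 'S_n fixing all points but the first i *)
Definition sub_sym n (i : nat) : {group 'S_n} :=
  Sym_group [set j : 'I_n | (j < i)%N].

Definition sub_group_ring (F : fieldType) n i :=
  enveloping_algebra_mx
    (subg_repr (regular_repr F [set: 'S_n]) (finset.subsetT (sub_sym n i))).

Inductive GZ (F : fieldType) (n : nat) : 'M[F]_#|[set: 'S_n]| -> Prop :=
| GZ_center i A of (0 < i <= n)%N & (A \in 'Z(sub_group_ring F n i))%MS : GZ A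
| GZ_one : GZ 1%:M
| GZ_lin a A B of GZ A & GZ B : GZ (a *: A + B)
| GZ_mul A B of GZ A & GZ B : GZ (A *m B).

(* The spectrum of GZ(n): its unital algebra morphisms to F, extended by 0
   outside GZ(n) so that distinct functions are distinct points. *)
Definition GZ_spectrum (F : fieldType) n : set ('M[F]_#|[set: 'S_n]| -> F) :=
  [set chi |
    [/\ chi 1%:M = 1,
        forall a A B, GZ A -> GZ B -> chi (a *: A + B) = a * chi A + chi B,
        forall A B, GZ A -> GZ B -> chi (A *m B) = chi A * chi B &
        forall A, ~ GZ A -> chi A = 0]]%classic.

Arguments GZ_spectrum F n : clear implicits.

(* Indices start from 0: this is the element X_(i+1) of the mathematical text. *)
Definition YJM (F : fieldType) n (i : 'I_n) : 'M[F]_#|[set: 'S_n]| :=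
  \sum_(j < n | (j < i)%N) regular_repr F [set: 'S_n] (tperm j i).

Definition has_weight F n (V : irrep F n) (v : 'rV[F]_(irrep_dim V))
    (a : {ffun 'I_n -> F}) : Prop :=
  forall i, v *m gring_op V (YJM F i) = a i *: v.

Definition Spec (F : fieldType) n : set {ffun 'I_n -> F} :=
  [set a | exists (P : gpath (branching_graph F) n) v,
     young_vector P v /\ has_weight v a]%classic.

Arguments Spec F n : clear implicits.

(* The module is V^la for la the common endpoint of the two paths. *)
Definition same_module (F : fieldType) n (a b : {ffun 'I_n -> F}) : Prop :=
  exists P Q : gpath (branching_graph F) n,
    [/\ P ord_max = Q ord_max,
        exists2 v, young_vector P v & has_weight v a &
        exists2 v, young_vector Q v & has_weight v b].

(** * Content vectors *)

Definition Cont (F : fieldType) n : set {ffun 'I_n -> F} :=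
  [set a | [/\ forall i : 'I_n, i = 0%N :> nat -> a i = 0,
      forall q : 'I_n, (0 < q)%N ->
        exists2 p : 'I_n, (p < q)%N & (a p = a q - 1 \/ a p = a q + 1) &
      forall p q : 'I_n, (p < q)%N -> a p = a q ->
        (exists2 r : 'I_n, (p < r < q)%N & a r = a p - 1) /\
        (exists2 r : 'I_n, (p < r < q)%N & a r = a p + 1)]]%classic.

Arguments Cont F n : clear implicits.

Definition admissible_step (F : fieldType) n (a b : {ffun 'I_n -> F}) : Prop :=
  exists i j : 'I_n,
    [/\ j = i.+1 :> nat, a j <> a i + 1, a j <> a i - 1 &
        b = [ffun k => a (tperm i j k)]].

Definition admissible_equiv (F : fieldType) n :
    {ffun 'I_n -> F} -> {ffun 'I_n -> F} -> Prop :=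
  clos_refl_trans _ (@admissible_step F n).

(* Main.v *)
(* The proof constructs all the irreducible representations. A standard tableau
   with n boxes is encoded by the sequence of the contents of its boxes; the
   sequences so obtained are those of Cont(n), two of them have the same shape iff
   they are permutations of each other, and they are then related by admissible
   transpositions (move the last occurrence of the last content of the other
   sequence to the end, and induct). On the span of the tableaux of a given shape,
   Young's orthogonal form satisfies the Coxeter relations, which define a
   representation of S_n since a word in the adjacent transpositions has a normal
   form. There X_k acts on a tableau by its k-th content, so that the X_k have
   distinct joint weights; as admissible transpositions connect all the tableaux,
   the representation is irreducible, and representations of different shapes are
   not isomorphic. The relation DU = UD + 1 of the Young lattice shows that the
   squares of the numbers of tableaux add up to n!, so there is no other
   irreducible representation. The branching multiplicities are read off the
   weights of X_1, ..., X_(n-1). Finally GZ(n) commutes with all the X_k, hence acts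
   on each tableau by a scalar, and these are all its characters since GZ(n) acts
   faithfully on the sum of the irreducible representations. *)

Require Import Defs.
From HB Require Import structures.
From mathcomp Require Import all_boot all_order all_algebra all_fingroup.
From mathcomp Require Import pgroup generic_quotient mxrepresentation finmap.
From mathcomp Require Import boolp classical_sets functions reals.
From mathcomp Require Import complex.
From mathcomp Require Import zify ring.
From Stdlib Require Import Relation_Operators.

Set Implicit Arguments.
Unset Strict Implicit.
Unset Printing Implicit Defensive.

Import Order.TTheory GRing.Theory Num.Theory.

Local Open Scope ring_scope.
Local Open Scope complex_scope.

(** * Content sequences *)

(** The spectrum is not analysed through the relations between s_i, X_i and X_(i+1). Once every
    irreducible representation is explicit, Spec(n), the branching multiplicities and the characters
    of GZ(n) are all read off from one fact: the joint weights of the X_k in an irreducible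
    representation are simple. The burden is then to know that the list is complete, and this is
    settled by counting. Shapes are handled as multisets of contents, so that adding a box is a
    local condition on three multiplicities, [curv] = 1; diagrams come in only to reach the Young
    graph. The constant 1 of DU = UD + 1 comes from [curv] having total sum 1: a diagram has one
    more addable than removable box. The orthogonal form takes its square roots in [F]. Its
    off-diagonal coefficient vanishes exactly at contents differing by 1, so the Coxeter relations
    can be verified without asking which of the permuted sequences are standard. *)

Definition mult (a : seq int) (c : int) : int := (count_mem c a)%:Z.

(* The second difference of the diagonal lengths of a diagram with contents [a]:
   it is 1 at the addable contents and -1 at the removable ones. *)
Definition curv (a : seq int) (c : int) : int :=
  mult a (c - 1) + mult a (c + 1) - 2 * mult a c + (c == 0)%R%:Z.

(* The 0-1 sequence (Maya diagram) encoding the boundary of the diagram. *)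
Definition maya (a : seq int) (c : int) : int :=
  mult a c - mult a (c - 1) + (0 < c)%R%:Z.

(** Bits everywhere means that the diagonal lengths drop by 0 or 1 at each step away from the main
    diagonal: [a] is the multiset of contents of a diagram. *)
Definition is_maya (a : seq int) := forall c, 0 <= maya a c <= 1.

(** Each entry must be addable to the multiset of the entries before it. These are kept in [u] in
    reverse order, which is harmless as [curv] sees only multiplicities. *)
Fixpoint lattice_from (u v : seq int) : bool :=
  if v is x :: v' then (curv u x == 1) && lattice_from (x :: u) v' else true.

Definition lattice (a : seq int) : bool := lattice_from [::] a.

Lemma mult_cons a x c : mult (x :: a) c = (x == c)%:Z + mult a c.
Proof. by rewrite /mult /= PoszD. Qed.

Lemma mult_cat a b c : mult (a ++ b) c = mult a c + mult b c.
Proof. by rewrite /mult count_cat PoszD. Qed.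

Lemma mult_ge0 a c : 0 <= mult a c.
Proof. by []. Qed.

Lemma mult_eq0 a c : (mult a c == 0) = (c \notin a).
Proof. by rewrite -has_pred1 has_count -leqNgt leqn0. Qed.

Lemma perm_mult a b : perm_eq a b -> mult a = mult b.
Proof. by move=> /seq.permP ab; apply: funext => c; rewrite /mult ab. Qed.

Lemma mult_perm a b : mult a =1 mult b -> perm_eq a b.
Proof. by move=> ab; apply/allP => c _; apply/eqP; have [] := ab c. Qed.

Lemma perm_curv a b : perm_eq a b -> curv a = curv b.
Proof. by move=> /perm_mult ab; apply: funext => c; rewrite /curv ab. Qed.

Lemma perm_is_maya a b : perm_eq a b -> is_maya a -> is_maya b.
Proof. by move=> /perm_mult ab + c => /(_ c); rewrite /maya ab. Qed.

(** In a Maya diagram, an addable content is thus a 01 at positions [c], [c + 1], a removable one a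
    10, and adding the box exchanges the two bits. *)
Lemma curv_maya a c : curv a c = maya a (c + 1) - maya a c.
Proof. rewrite /curv /maya addrK; lia. Qed.

Lemma is_maya_curv a c : is_maya a -> -1 <= curv a c <= 1.
Proof. by move=> a_maya; rewrite curv_maya; move: (a_maya c) (a_maya (c + 1)); lia. Qed.

Lemma curv_cons a x c :
  curv (x :: a) c =
  curv a c + (x == c - 1)%R%:Z + (x == c + 1)%R%:Z - 2 * (x == c)%:Z.
Proof. rewrite /curv !mult_cons; lia. Qed.

Lemma maya_cons a x c :
  maya (x :: a) c = maya a c + (x == c)%:Z - (x == c - 1)%R%:Z.
Proof. rewrite /maya !mult_cons; lia. Qed.

Lemma is_maya0 : is_maya [::].
Proof. by move=> c; rewrite /maya /mult /=; lia. Qed.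

Lemma is_maya_cons a x : is_maya a -> curv a x = 1 -> is_maya (x :: a).
Proof.
move=> a_maya; rewrite curv_maya => ax c; rewrite maya_cons.
move: (a_maya c) (a_maya x) (a_maya (x + 1)).
have [<-|xc] := eqVneq x c; first by have -> : (x == x - 1) = false; lia.
have [xc1|] := eqVneq x (c - 1); last lia.
by move: ax; rewrite xc1 subrK; lia.
Qed.

Lemma perm_rem_cons (a : seq int) x : x \in a -> perm_eq (x :: rem x a) a.
Proof. by move=> xa; rewrite perm_sym perm_to_rem. Qed.

Lemma curv_rem a x c : x \in a ->
  curv (rem x a) c =
  curv a c - (x == c - 1)%R%:Z - (x == c + 1)%R%:Z + 2 * (x == c)%:Z.
Proof. by move=> /perm_rem_cons/perm_curv <-; rewrite curv_cons; lia. Qed.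

Lemma curv_lt0_mem a x : curv a x = -1 -> x \in a.
Proof.
rewrite -[x \in a]negbK -mult_eq0 /curv; move: (mult_ge0 a (x - 1)).
by move: (mult_ge0 a (x + 1)); case: eqVneq => [->|]; lia.
Qed.

Lemma is_maya_rem a x : is_maya a -> curv a x = -1 -> is_maya (rem x a).
Proof.
move=> a_maya ax; have xa := curv_lt0_mem ax.
have E c : maya a c = maya (rem x a) c + (x == c)%:Z - (x == c - 1)%R%:Z.
  by rewrite -maya_cons /maya (perm_mult (perm_rem_cons xa)).
rewrite curv_maya in ax.
move=> c; move: ax (E c) (a_maya c) (a_maya x) (a_maya (x + 1)).
have [<-|xc] := eqVneq x c; first by have -> : (x == x - 1) = false; lia.
have [xc1|] := eqVneq x (c - 1); last lia.
by rewrite xc1 subrK; lia.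
Qed.

Lemma lattice_from_perm u u' v :
  perm_eq u u' -> lattice_from u v = lattice_from u' v.
Proof.
elim: v u u' => //= x v IHv u u' uu'.
by rewrite (perm_curv uu') (IHv (x :: u) (x :: u')) // perm_cons.
Qed.

Lemma lattice_from_cat u v w :
  lattice_from u (v ++ w) = lattice_from u v && lattice_from (v ++ u) w.
Proof.
elim: v u => //= x v IHv u; rewrite IHv -andbA.
congr [&& _, _ & _]; apply: lattice_from_perm.
by apply/seq.permP => p; rewrite /= !count_cat /= addnCA.
Qed.

Lemma lattice_cat u v : lattice (u ++ v) = lattice u && lattice_from u v.
Proof. by rewrite /lattice lattice_from_cat cats0. Qed.

Lemma lattice_rcons a x : lattice (rcons a x) = lattice a && (curv a x == 1).
Proof. by rewrite -cats1 lattice_cat /= andbT. Qed.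

Lemma lattice_is_maya a : lattice a -> is_maya a.
Proof.
elim/last_ind: a => [_|a x IHa]; first exact: is_maya0.
rewrite lattice_rcons => /andP[/IHa a_maya /eqP ax].
by apply: perm_is_maya (is_maya_cons a_maya ax); rewrite perm_sym perm_rcons.
Qed.

(** A nonzero content has curvature 1 only if one of its neighbours is present, so each entry widens
    the range by at most one. This makes the search window of [lattices] large enough. *)
Lemma lattice_bound a x : lattice a -> x \in a -> `|x| < (size a)%:Z.
Proof.
elim/last_ind: a x => // a y IHa x; rewrite lattice_rcons => /andP[aP ay].
rewrite mem_rcons inE size_rcons => /predU1P[->|/(IHa x aP)]; last by lia.
have [y0|y0] := eqVneq y 0; first by rewrite y0; lia.
have: (y - 1 \in a) || (y + 1 \in a).
  rewrite -[_ || _]negbK negb_or -!mult_eq0; move: ay; rewrite /curv.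
  by move: (mult_ge0 a y); lia.
by case/orP => /(IHa _ aP); lia.
Qed.

Lemma curv_nil x : (curv [::] x == 1) = (x == 0).
Proof. by rewrite /curv /mult /=; case: (x == 0). Qed.

Lemma lattice_head x a : lattice (x :: a) -> x = 0.
Proof. by case/andP; rewrite curv_nil => /eqP. Qed.

Lemma lattice_neq1 u x y v : lattice (u ++ x :: y :: v) -> x != y.
Proof.
rewrite lattice_cat /= curv_cons => /and4P[_ ux uy _].
by apply: contraTneq uy => <-; move: ux; lia.
Qed.

(** Adding [x] brings its curvature down to -1, and the single entry [y] raises it to 0 at most. The
    braid relation needs three distinct consecutive contents. *)
Lemma lattice_neq2 u x y z v : lattice (u ++ x :: y :: z :: v) -> x != z.
Proof.
rewrite lattice_cat /= !curv_cons => /and5P[_ ux _ uz _].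
by apply: contraTneq uz => <-; move: ux; lia.
Qed.

(** An entry changes the curvature only at itself and at its two neighbours, so distinct
    non-neighbouring contents do not affect each other. *)
Lemma lattice_swap u x y v : y != x + 1 -> y != x - 1 ->
  lattice (u ++ x :: y :: v) = lattice (u ++ y :: x :: v).
Proof.
move=> yx1 yx2; rewrite !lattice_cat /= !curv_cons; congr (_ && _).
rewrite (@lattice_from_perm [:: y, x & u] [:: x, y & u]) ?andbA; last first.
  by apply/seq.permP => p /=; lia.
by congr (_ && _); have [->//|] := eqVneq x y; lia.
Qed.

(** * Admissible transpositions connect the tableaux of a shape *)

Definition adm_step (a b : seq int) : Prop := exists u x y v,
  [/\ a = u ++ x :: y :: v, b = u ++ y :: x :: v, y != x + 1 & y != x - 1].

Definition adm_equiv : seq int -> seq int -> Prop := clos_refl_trans _ adm_step.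

Lemma adm_step_perm a b : adm_step a b -> perm_eq a b.
Proof.
move=> [u [x [y [v [-> -> _ _]]]]]; rewrite perm_cat2l.
by apply/seq.permP => p /=; lia.
Qed.

Lemma adm_step_lattice a b : adm_step a b -> lattice a = lattice b.
Proof. by move=> [u [x [y [v [-> -> yx1 yx2]]]]]; apply: lattice_swap. Qed.

Lemma adm_equiv_perm a b : adm_equiv a b -> perm_eq a b.
Proof.
elim=> [? ? /adm_step_perm//|//|x y z _ xy _ yz].
exact: perm_trans xy yz.
Qed.

Lemma adm_equiv_lattice a b : adm_equiv a b -> lattice a = lattice b.
Proof. by elim=> [? ? /adm_step_lattice//|//|x y z _ -> _ ->]. Qed.

Lemma adm_equiv_rcons a b x :
  adm_equiv a b -> adm_equiv (rcons a x) (rcons b x).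
Proof.
elim=> [{}a {}b|{}a|{}a c {}b _ ac _ cb]; last 2 first.
- exact: rt_refl.
- exact: rt_trans ac cb.
move=> [u [y [z [v [-> -> zy1 zy2]]]]]; apply: rt_step.
by exists u, y, z, (rcons v x); rewrite !rcons_cat.
Qed.

Lemma adm_equiv_shift u x v :
  x - 1 \notin v -> x + 1 \notin v -> adm_equiv (u ++ x :: v) (rcons (u ++ v) x).
Proof.
elim: v u => [|y v IHv] u; first by rewrite cats0 cats1 => *; apply: rt_refl.
rewrite !inE !negb_or => /andP[xy1 xv1] /andP[xy2 xv2].
apply: (@rt_trans _ _ _ (u ++ y :: x :: v)).
  by apply: rt_step; exists u, x, y, v; split => //; rewrite eq_sym.
by rewrite -[u ++ y :: x :: v]cat_rcons -[u ++ y :: v]cat_rcons; apply: IHv.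
Qed.

Lemma mem_split_last (x : int) (s : seq int) : x \in s ->
  exists u v : seq int, s = u ++ x :: v /\ x \notin v.
Proof.
elim: s => // y s IHs; rewrite inE; have [/IHs[u [v [-> xv]]] _|xs] := boolP (x \in s).
  by exists (y :: u), v.
by rewrite ?(negPf xs) ?orbF => /eqP xy; exists [::], s; rewrite -xy.
Qed.

(* The last occurrence in [a] of the last entry [x] of [b] is followed by no
   [x - 1] and no [x + 1], since the curvature at [x] is -1 both just after that
   occurrence and at the end. *)
Lemma lattice_adm_equiv a b :
  lattice a -> lattice b -> perm_eq a b -> adm_equiv a b.
Proof.
elim/last_ind: b a => [|b x IHb] a aP.
  by move=> _ /perm_nilP ->; apply: rt_refl.
rewrite lattice_rcons => /andP[bP bx] ab.
have xa : x \in a by rewrite (perm_mem ab) mem_rcons mem_head.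
have [u [v [def_a xv]]] := mem_split_last xa.
have ax : curv a x = -1.
  by rewrite (perm_curv ab) (perm_curv (permEl (perm_rcons _ _))) curv_cons; lia.
have [ux vP] : curv u x = 1 /\ lattice_from (x :: u) v.
  by move: aP; rewrite def_a lattice_cat /= => /and3P[_ /eqP].
have [v1 v2] : x - 1 \notin v /\ x + 1 \notin v.
  move: ax ux xv; rewrite def_a /curv !mult_cat !mult_cons -!mult_eq0.
  by move: (mult_ge0 v (x - 1)) (mult_ge0 v (x + 1)); lia.
have a_uv := adm_equiv_shift u v1 v2.
have uvP : lattice (u ++ v).
  by move: aP; rewrite def_a (adm_equiv_lattice a_uv) lattice_rcons => /andP[].
rewrite def_a; apply: (rt_trans _ _ _ _ _ a_uv); apply/adm_equiv_rcons/IHb => //.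
apply/seq.permP => p; move/seq.permP/(_ p): ab.
by rewrite def_a -cats1 !count_cat /=; lia.
Qed.

(** * Counting standard tableaux *)

Definition addable (a : seq int) (c : int) : bool := curv a c == 1.
Definition removable (a : seq int) (c : int) : bool := curv a c == -1.

Definition zrange (N : nat) : seq int := [seq i%:Z - N%:Z | i <- iota 0 N.*2.+1].

Lemma mem_zrange N c : (c \in zrange N) = (`|c| <= N%:Z).
Proof.
apply/mapP/idP => [[k]|cN]; first by rewrite mem_iota => kN ->; lia.
by exists (absz (c + N%:Z)); rewrite ?mem_iota; lia.
Qed.

Lemma zrange_uniq N : uniq (zrange N).
Proof. by rewrite map_inj_uniq ?iota_uniq // => i j; lia. Qed.

(* Entries are searched in [-N, N], which is no restriction for n <= N. *)
Fixpoint lattices (N n : nat) : seq (seq int) :=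
  if n is n'.+1 then
    [seq rcons a c | a <- lattices N n', c <- [seq c <- zrange N | addable a c]]
  else [:: [::]].

(** The number of standard tableaux of the shape whose multiset of contents is that of [a], when
    [n <= N]. *)
Definition ntableaux (N n : nat) (a : seq int) : nat := count (perm_eq a) (lattices N n).

Lemma lattices_uniq N n : uniq (lattices N n).
Proof.
elim: n => //= n IHn; apply: allpairs_uniq_dep => // [a _|[a c] [b d] _ _ /=].
  exact: filter_uniq (zrange_uniq N).
by move=> /rcons_inj[-> ->].
Qed.

Lemma mem_lattices N n a : (n <= N)%N ->
  (a \in lattices N n) = (size a == n) && lattice a.
Proof.
elim: n a => [|n IHn] a nN; first by case: a.
apply/allpairsPdep/andP => [ [b [c []]]|[]].
  rewrite mem_filter IHn; last exact: ltnW.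
  move=> /andP[/eqP bn bP] /andP[bc _] ->.
  by rewrite size_rcons bn eqxx lattice_rcons bP.
case/lastP: a => // a c; rewrite size_rcons eqSS => /eqP an acP.
have := acP; rewrite lattice_rcons => /andP[aP ac]; exists a, c.
split=> //; first by rewrite IHn ?an ?eqxx // ltnW.
rewrite mem_filter /addable ac mem_zrange /=.
have := @lattice_bound _ c acP; rewrite mem_rcons mem_head size_rcons an.
by move=> /(_ isT); lia.
Qed.

Lemma sum_lattices N n (F : seq int -> nat) :
  (\sum_(a <- lattices N n.+1) F a =
   \sum_(a <- lattices N n) \sum_(c <- zrange N | addable a c) F (rcons a c))%N.
Proof.
by rewrite [LHS]big_allpairs_dep; apply: eq_bigr => a _; rewrite big_filter.
Qed.

Lemma ntableauxE N n a : ntableaux N n a = (\sum_(b <- lattices N n) perm_eq a b)%N.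
Proof. by rewrite /ntableaux -sum1_count big_mkcond. Qed.

Lemma ntableaux_perm N n a b : perm_eq a b -> ntableaux N n a = ntableaux N n b.
Proof. by move=> ab; apply: eq_count => c; apply: permPl. Qed.

(** The last entry of a tableau is a removable content of the shape, since adding it took its
    curvature from 1 to -1. *)
Lemma ntableauxS N n a :
  ntableaux N n.+1 a = (\sum_(c <- zrange N | removable a c) ntableaux N n (rem c a))%N.
Proof.
rewrite ntableauxE sum_lattices.
under eq_bigr do rewrite big_mkcond.
rewrite exchange_big [RHS]big_mkcond /=; apply: eq_bigr => c _.
have rcons_perm b : perm_eq (rcons b c) (c :: b) by rewrite perm_rcons.
case: ifP; rewrite /removable => ac.
  have ca := curv_lt0_mem (eqP ac).
  rewrite ntableauxE; apply: eq_bigr => b _.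
  rewrite (permPr (rcons_perm b)) -(permPl (perm_rem_cons ca)) perm_cons.
  have [ab|_] := boolP (perm_eq (rem c a) b); last by case: ifP.
  by case: ifP => //; rewrite /addable -(perm_curv ab) curv_rem // (eqP ac); lia.
rewrite big1 // => b _; case: ifP => // /eqP bc; apply/eqP; rewrite eqb0.
apply/negP => ab; move: ac.
by rewrite (perm_curv ab) (perm_curv (rcons_perm b)) curv_cons bc; lia.
Qed.

Lemma sum_zrange1 N y : `|y| <= N%:Z -> \sum_(c <- zrange N) (y == c)%R%:Z = 1.
Proof.
rewrite -mem_zrange => yN; rewrite (bigD1_seq y) ?zrange_uniq //= eqxx.
by rewrite big1 ?addr0 // => c /negPf; rewrite eq_sym => ->.
Qed.

Lemma bigD1_zrange N (P : pred int) (F : int -> nat) c :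
  c \in zrange N -> P c ->
  (\sum_(x <- zrange N | P x) F x =
   F c + \sum_(x <- zrange N | P x && (x != c)) F x)%N.
Proof.
move=> cN Pc; rewrite -big_filter (bigD1_seq c) ?filter_uniq ?zrange_uniq //.
  by rewrite big_filter_cond.
by rewrite mem_filter Pc.
Qed.

(** Each box contributes 1 + 1 - 2 = 0, and only the term at [c == 0] survives. The strict bound
    keeps both neighbours of each content inside the window. *)
Lemma sum_curv N a :
  (forall x, x \in a -> `|x| < N%:Z) -> \sum_(c <- zrange N) curv a c = 1.
Proof.
elim: a => [_|x a IHa aN].
  rewrite -[RHS](@sum_zrange1 N 0) ?normr0 //; apply: eq_bigr => c _.
  by rewrite /curv /mult /= eq_sym.
have xN := aN x (mem_head _ _).
under eq_bigr => c _.
  rewrite curv_cons [x == c - 1](_ : _ = (x + 1 == c)); last by lia.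
  rewrite [x == c + 1](_ : _ = (x - 1 == c)); last by lia.
over.
rewrite sumrB 2!big_split -mulr_sumr /= !sum_zrange1 ?IHa; try by lia.
by move=> y ya; apply: aN; rewrite inE ya orbT.
Qed.

(** Since [curv] takes only the values -1, 0 and 1, its sum is the number of addable contents minus
    the number of removable ones. *)
Lemma count_curv N a :
  is_maya a -> (forall x, x \in a -> `|x| < N%:Z) ->
  (\sum_(c <- zrange N | addable a c) 1 =
   (\sum_(c <- zrange N | removable a c) 1).+1)%N.
Proof.
move=> a_maya /sum_curv aN.
suff: (\sum_(c <- zrange N | addable a c) 1)%N%:Z =
      (\sum_(c <- zrange N | removable a c) 1)%N%:Z + 1 by lia.
rewrite -aN -!natz !natr_sum [in RHS]big_mkcond [in LHS]big_mkcond -big_split /=.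
by apply: eq_bigr => c _; rewrite /addable /removable;
  move: (@is_maya_curv a c a_maya); do 2!case: eqP; lia.
Qed.

(* [U] and [D] being the up and down operators of the Young lattice, this is the
   relation DU = UD + 1 applied to the number of paths. *)
Lemma sum_ntableaux_cons N n a :
  is_maya a -> (forall x, x \in a -> `|x| < N%:Z) -> size a = n ->
  (\sum_(c <- zrange N | addable a c) ntableaux N n.+1 (c :: a) =
   n.+1 * ntableaux N n a)%N.
Proof.
elim/ltn_ind: n a => n IHn a a_maya aN an.
(* Removing [s = c] from [c :: a] gives [a] back. Another [s] is removable after [c] was added iff
   it is removable in [a] and [c] is addable once [s] is removed, so the two moves can be
   exchanged. *)
have up_down c : c \in zrange N -> addable a c ->
    (ntableaux N n.+1 (c :: a) = ntableaux N n a +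
      \sum_(s <- zrange N | removable a s)
        if (c != s) && addable (rem s a) c then ntableaux N n (c :: rem s a) else 0)%N.
  move=> cN ac; rewrite ntableauxS (bigD1_zrange _ cN) //=; last first.
    by move: ac; rewrite /removable /addable curv_cons => /eqP ->; lia.
  rewrite eqxx -big_mkcondr; congr (_ + _)%N.
  rewrite (eq_bigr (fun s => ntableaux N n (c :: rem s a))); last first.
    by move=> s /andP[_ /negPf]; rewrite eq_sym => ->.
  apply: eq_bigl => s; move: ac; rewrite /removable /addable curv_cons => /eqP ac.
  have := is_maya_curv s a_maya; have := is_maya_curv c a_maya.
  have [sa|] := boolP (curv a s == -1); last by lia.
  by rewrite curv_rem ?curv_lt0_mem ?(eqP sa) // ac; lia.
(* The same double sum seen from below: it is the induction hypothesis at each [rem s a], where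
   re-adding [s] itself accounts for the term [ntableaux N n a]. *)
have down_up : (\sum_(s <- zrange N | removable a s) (ntableaux N n a +
      \sum_(c <- zrange N | addable a c)
        if (c != s) && addable (rem s a) c then ntableaux N n (c :: rem s a) else 0) =
    n * ntableaux N n a)%N.
  case: n IHn an {up_down} => [|n] IHn an.
    rewrite mul0n big1 // => s /eqP/curv_lt0_mem.
    by move/size0nil: an => ->.
  rewrite [in RHS]ntableauxS big_distrr; apply: eq_bigr => s /eqP sa /=.
  have s_a := curv_lt0_mem sa; have sN : s \in zrange N by rewrite mem_zrange ltW ?aN.
  rewrite -(IHn n _ (rem s a)) ?size_rem ?an //; first last.
  - by move=> x /mem_rem; apply: aN.
  - exact: is_maya_rem.
  rewrite [RHS](bigD1_zrange _ sN) //=; first last.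
  - by rewrite /addable curv_rem // sa; lia.

  rewrite (ntableaux_perm _ _ (perm_rem_cons s_a)) -big_mkcondr; congr (_ + _)%N.
  apply: eq_bigl => c; rewrite /addable curv_rem //.
  have := is_maya_curv c a_maya.
  by have [<-|] := eqVneq s c; lia.
rewrite mulSn -down_up big_seq_cond.
under eq_bigr => c /andP[cN ac] do rewrite up_down //.
rewrite -big_seq_cond !big_split /= exchange_big addnA; congr (_ + _)%N.
have sum_const P : (\sum_(c <- zrange N | P c) ntableaux N n a =
    (\sum_(c <- zrange N | P c) 1) * ntableaux N n a)%N.
  by rewrite big_distrl; apply: eq_bigr => c _; rewrite [RHS]mul1n.
by rewrite !sum_const (count_curv a_maya aN) mulSn.
Qed.

(** Summing over tableaux instead of shapes counts each shape as often as it has tableaux, so the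
    left side is the sum of the squares, without choosing a representative of each shape. *)
Lemma sum_ntableaux N n :
  (n <= N)%N -> (\sum_(a <- lattices N n) ntableaux N n a = n`!)%N.
Proof.
elim: n => [|n IHn] nN; first by rewrite big_seq1.
rewrite sum_lattices factS -IHn; last exact: ltnW.
rewrite big_distrr /= !big_seq; apply: eq_bigr => a.
rewrite mem_lattices; last exact: ltnW.
case/andP=> /eqP an aP; rewrite -sum_ntableaux_cons //.
- apply: eq_bigr => c _; apply: ntableaux_perm; exact: permEl (perm_rcons _ _).
- exact: lattice_is_maya.
by move=> x xa; have := lattice_bound aP xa; rewrite an; lia.
Qed.

(** * Words in the adjacent transpositions *)

(** Indexed by naturals, with value 1 out of range, so that words are plain sequences and the same
    index serves in 'S_n and 'S_n.+1. *)
Definition adjtp (n k : nat) : 'S_n :=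
  if insub k is Some i then if insub k.+1 is Some j then tperm i j else 1%g
  else 1%g.

Lemma adjtpE n (i j : 'I_n) : j = i.+1 :> nat -> adjtp n i = tperm i j.
Proof. by rewrite /adjtp valK => <-; rewrite valK. Qed.

Lemma adjtp_nat n k (x : 'I_n) : (k.+1 < n)%N ->
  adjtp n k x = (if x == k :> nat then k.+1
                 else if x == k.+1 :> nat then k else x) :> nat.
Proof.
move=> kn; have k'n := ltnW kn.
rewrite (@adjtpE n (Ordinal k'n) (Ordinal kn)) // permE /= -!val_eqE /=.
by do 2!case: ifP => //.
Qed.

Ltac split_ifs :=
  repeat match goal with
  | |- context [if ?b then _ else _] =>
    lazymatch b with
    | context [if _ then _ else _] => fail
    | _ => let E := fresh in destruct b eqn:E
    end
  end.

Lemma adjtpK n k : (adjtp n k * adjtp n k = 1)%g.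
Proof.
rewrite /adjtp; case: (insub k) => [x|]; last exact: mulg1.
by case: (insub k.+1) => [y|]; rewrite ?tperm2 ?mulg1.
Qed.

Lemma adjtp_braid n k : (k.+2 < n)%N ->
  (adjtp n k * adjtp n k.+1 * adjtp n k =
   adjtp n k.+1 * adjtp n k * adjtp n k.+1)%g.
Proof.
move=> kn; have k'n := ltnW kn; apply/permP => x; apply: val_inj => /=.
rewrite !permM !adjtp_nat //.
by split_ifs; lia.
Qed.

Lemma adjtpC n j k : (j.+1 < k)%N -> (k.+1 < n)%N ->
  (adjtp n j * adjtp n k = adjtp n k * adjtp n j)%g.
Proof.
move=> jk kn; have jn : (j.+1 < n)%N by lia.
apply/permP => x; apply: val_inj => /=; rewrite !permM !adjtp_nat //.
by split_ifs; lia.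
Qed.

Lemma adjtp_ind n (P : 'S_n -> Prop) :
  P 1%g -> (forall g k, (k.+1 < n)%N -> P g -> P (g * adjtp n k)%g) ->
  forall g, P g.
Proof.
move=> P1 Padj g; have [ts -> _] := prod_tpermP g.
elim/last_ind: ts => [|ts [i j] IHts]; first by rewrite big_nil.
rewrite -cats1 big_cat big_seq1 /=; move: (\prod_(_ <- _) _)%g IHts => {ts}g Pg.
wlog ij : i j / (i <= j)%N => [IH|].
  by have [|/ltnW] := leqP i j; [|rewrite tpermC]; apply: IH.
have [d] := ubnP (j - i); elim: d i j g ij Pg => // d IHd i j g ij Pg.
rewrite ltnS => ji_d; have [ji|ji] := eqVneq j i; first by rewrite ji tperm1 mulg1.
rewrite -val_eqE /= in ji; have jn := ltn_ord j; have j'n : (j.-1 < n)%N by lia.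
have j'j : j = (Ordinal j'n).+1 :> nat by rewrite /=; lia.
have [->|ij'] := eqVneq i (Ordinal j'n).
  by rewrite -(adjtpE j'j); apply: Padj; rewrite //= -j'j.
(* Conjugation by the adjacent transposition at [j - 1] brings [j] one step closer to [i]. *)
have -> : tperm i j = (adjtp n j.-1 * tperm i (Ordinal j'n) * adjtp n j.-1)%g.
  rewrite (adjtpE j'j) -{1}(tpermV (Ordinal j'n) j) -mulgA -conjgE tpermJ.
  by rewrite tpermL tpermD // eq_sym.
rewrite !mulgA; apply: (Padj); first lia.
apply: IHd; [by rewrite /=; lia| |by rewrite /=; lia].
by apply: Padj => //; lia.
Qed.

(** * Normal forms of words under the Coxeter relations *)

Section CoxeterWords.

Variables (T : Type) (op : T -> T -> T) (e : T).
Hypotheses (opA : associative op) (op1x : left_id e op) (opx1 : right_id e op).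
Local Notation "x * y" := (op x y).

Variables (n : nat) (A : nat -> T).
Hypothesis Ainv : forall k, (k.+1 < n)%N -> A k * A k = e.
Hypothesis Abraid : forall k, (k.+2 < n)%N ->
  A k * A k.+1 * A k = A k.+1 * A k * A k.+1.
Hypothesis Acomm : forall j k, (j.+1 < k)%N -> (k.+1 < n)%N -> A j * A k = A k * A j.

Fixpoint word_prod (w : seq nat) : T := if w is k :: w' then A k * word_prod w' else e.

Lemma word_prod_cat u v : word_prod (u ++ v) = word_prod u * word_prod v.
Proof. by elim: u => [|k u /= ->]; rewrite ?op1x ?opA. Qed.

(** The product A_(k+l-1) ... A_(k+1) A_k. For k + l = m + 1 and varying k these represent, in the
    symmetric group, the right cosets of the subgroup generated by the s_j with j < m; [k] is the
    image of the point m + 1. *)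
Fixpoint desc_prod (k l : nat) : T := if l is l'.+1 then desc_prod k.+1 l' * A k else e.

Lemma desc_prod_below k l j : (j.+1 < k)%N -> (k + l < n)%N ->
  desc_prod k l * A j = A j * desc_prod k l.
Proof.
elim: l k => [|l IHl] k jk kn /=; first by rewrite opx1 op1x.
by rewrite -opA -Acomm ?opA ?IHl //; lia.
Qed.

(** Going left, [A j] commutes with the factors up to A_(j-2), then A_j A_(j-1) A_j = A_(j-1) A_j
    A_(j-1), and the leading A_(j-1) commutes with all that remains. *)
Lemma desc_prod_inside k l j : (k < j < k + l)%N -> (k + l < n)%N ->
  desc_prod k l * A j = A j.-1 * desc_prod k l.
Proof.
elim: l k => [|l IHl] k /=; first lia.
have [->|jk] := eqVneq j k.+1; last first.
  by move=> kj kn; rewrite -opA Acomm ?opA ?IHl //; lia.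
case: l {IHl} => [|l] kj kn /=; first lia.
rewrite -!opA [A k.+1 * _]opA -Abraid ?opA; last lia.
by rewrite desc_prod_below //; lia.
Qed.

(** A new letter [j] passes through the coset representative into the left factor if j + 1 < k,
    lengthens it if j + 1 = k, shortens it if j = k, and passes through as j - 1 if j > k. *)
Lemma word_prod_normal m w : (m.+1 < n)%N -> all (fun k => k <= m)%N w ->
  exists w' k, [/\ all (fun k => k < m)%N w', (k <= m.+1)%N &
    word_prod w = word_prod w' * desc_prod k (m.+1 - k)].
Proof.
move=> mn; elim/last_ind: w => [|w j IHw].
  by exists [::], m.+1; rewrite subnn opx1.
rewrite all_rcons => /andP[jm /IHw[w' [k [w'm km Ew]]]].
rewrite -cats1 word_prod_cat {}Ew /= opx1.
have [jk|jk] := ltnP j.+1 k.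
  exists (rcons w' j), k; rewrite all_rcons w'm andbT; split=> //; first lia.
  by rewrite -cats1 word_prod_cat /= opx1 -!opA desc_prod_below //; lia.
have [jk1|jk1] := eqVneq j.+1 k.
  exists w', j; split=> //; first lia.
  by rewrite -jk1 subSS subSn //= opA.
have [jk2|jk2] := eqVneq j k.
  exists w', k.+1; split=> //; first lia.
  by rewrite -jk2 subSS subSn //= -!opA Ainv ?opx1 //; lia.
exists (rcons w' j.-1), k; rewrite all_rcons w'm andbT; split=> //; first lia.
by rewrite -cats1 word_prod_cat /= opx1 -!opA desc_prod_inside //; lia.
Qed.

End CoxeterWords.

(** Serves to normalise a word in permutations and in matrices simultaneously, with the same normal
    form. *)
Lemma word_prod_pair (T1 T2 : Type) (op1 : T1 -> T1 -> T1) (op2 : T2 -> T2 -> T2)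
    e1 e2 A1 A2 w :
  word_prod (fun x y => (op1 x.1 y.1, op2 x.2 y.2)) (e1, e2)
    (fun k => (A1 k, A2 k)) w = (word_prod op1 e1 A1 w, word_prod op2 e2 A2 w).
Proof. by elim: w => //= k w ->. Qed.

Definition perm_word n : seq nat -> 'S_n := @word_prod 'S_n mulg 1%g (adjtp n).

Lemma perm_wordP n (g : 'S_n) :
  exists2 w, all (fun k => k.+1 < n)%N w & perm_word n w = g.
Proof.
elim/adjtp_ind: g => [|g k kn [w wn <-]]; first by exists [::].
exists (rcons w k); first by rewrite all_rcons kn.
rewrite -cats1 /perm_word word_prod_cat /= ?mulg1 //; exact: mulgA || exact: mul1g.
Qed.

Lemma perm_word_cat n u v : perm_word n (u ++ v) = (perm_word n u * perm_word n v)%g.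
Proof. by apply: word_prod_cat => [x y z|x]; rewrite ?mulgA ?mul1g. Qed.

Lemma perm_word_fix n w (x : 'I_n) :
  all (fun k => k.+1 < x)%N w -> perm_word n w x = x.
Proof.
elim: w => [|k w IHw] /=; first by rewrite perm1.
case/andP=> kx wx; rewrite permM; have kn := ltn_trans kx (ltn_ord x).
have -> : adjtp n k x = x by apply: val_inj; rewrite /= adjtp_nat //; split_ifs; lia.
exact: IHw.
Qed.

Lemma desc_prod_perm n k l (x : 'I_n) : x = (k + l)%N :> nat ->
  @desc_prod 'S_n mulg 1%g (adjtp n) k l x = k :> nat.
Proof.
elim: l k => [|l IHl] k /= xkl; first by rewrite perm1 xkl addn0.
have kn : (k.+1 < n)%N by have := ltn_ord x; lia.
have /IHl E : x = (k.+1 + l)%N :> nat by rewrite addSnnS.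
by rewrite permM adjtp_nat // E eqxx ifN //; lia.
Qed.

(** * Matrices satisfying the Coxeter relations define a representation *)

Section CoxeterRepresentation.

Variables (F : fieldType) (d n : nat) (A : nat -> 'M[F]_d).
Hypothesis Ainv : forall k, (k.+1 < n)%N -> A k *m A k = 1%:M.
Hypothesis Abraid : forall k, (k.+2 < n)%N ->
  A k *m A k.+1 *m A k = A k.+1 *m A k *m A k.+1.
Hypothesis Acomm : forall j k, (j.+1 < k)%N -> (k.+1 < n)%N ->
  A j *m A k = A k *m A j.

Let mx_word : seq nat -> 'M[F]_d := word_prod mulmx 1%:M A.

Lemma mx_word_cat u v : mx_word (u ++ v) = mx_word u *m mx_word v.
Proof. by elim: u => [|k u /= ->]; rewrite ?mul1mx ?mulmxA. Qed.

(** The Coxeter relations present the symmetric group. In the normal form of a word with trivial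
    permutation the coset representative must be trivial, which leaves a word in smaller letters. *)
Lemma mx_word_ker w :
  all (fun k => k.+1 < n)%N w -> perm_word n w = 1%g -> mx_word w = 1%:M.
Proof.
have [m mn] : exists m, (m = n.-1)%N by exists n.-1.
move=> wn; have {wn}: all (fun k => k < m)%N w.
  by apply: sub_all wn => k; lia.
have {mn}: (m <= n.-1)%N by lia.
elim: m w => [|m IHm] w mn wm; first by case: w wm.
have {}mn : (m.+1 < n)%N by lia.
pose op (x y : 'S_n * 'M[F]_d) := ((x.1 * y.1)%g, x.2 *m y.2).
pose B k := (adjtp n k, A k).
have opA : associative op by move=> x y z; rewrite /op mulgA mulmxA.
have op1 : left_id (1%g, 1%:M) op by case=> g X; rewrite /op mul1g mul1mx.
have opx1 : right_id (1%g, 1%:M) op by case=> g X; rewrite /op mulg1 mulmx1.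
have [] := @word_prod_normal _ op (1%g, 1%:M) opA op1 opx1 n B _ _ _ m w mn wm.
- by move=> k kn; rewrite /op /= adjtpK Ainv.
- by move=> k kn; rewrite /op /= adjtp_braid ?Abraid.
- by move=> j k jk kn; congr (_, _); [apply: adjtpC | apply: Acomm].
move=> w' [k [w'm km]]; rewrite !word_prod_pair.
have -> l : desc_prod op (1%g, 1%:M) B k l =
    (@desc_prod 'S_n mulg 1%g (adjtp n) k l, desc_prod mulmx 1%:M A k l).
  by elim: l k {km} => //= l IHl k; rewrite IHl.
case=> Ew EA w1; have [mk|mk] := eqVneq k m.+1.
  rewrite /mx_word EA mk subnn /= mulmx1; apply: IHm => //; first lia.
  by rewrite -w1 /perm_word Ew mk subnn /= mulg1.
(* The point m + 1 is fixed by [w'] and sent to [k] by the representative, so a trivial permutation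
   forces k = m + 1. *)
have := congr1 (fun g : 'S_n => nat_of_ord (g (Ordinal mn))) w1.
rewrite /perm_word Ew permM (@perm_word_fix _ w'); last first.
  by apply: sub_all w'm => j /=; lia.
by rewrite perm1 desc_prod_perm /= ?subnKC //; lia.
Qed.

Definition cox_repr (g : 'S_n) : 'M[F]_d := mx_word (s2val (cid2 (perm_wordP g))).

Lemma mx_word_rev w :
  all (fun k => k.+1 < n)%N w -> mx_word (w ++ rev w) = 1%:M.
Proof.
elim: w => //= k w IHw /andP[kn wn]; rewrite rev_cons -rcons_cat -cats1.
by rewrite mx_word_cat IHw // mul1mx /= mulmx1 Ainv.
Qed.

Lemma perm_word_rev w : perm_word n (w ++ rev w) = 1%g.
Proof.
elim: w => //= k w IHw; rewrite rev_cons -rcons_cat -cats1.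
by rewrite perm_word_cat IHw mul1g /perm_word /= mulg1 adjtpK.
Qed.

Lemma cox_repr_word w :
  all (fun k => k.+1 < n)%N w -> cox_repr (perm_word n w) = mx_word w.
Proof.
move=> wn; rewrite /cox_repr; case: cid2 => u /= un uw.
have: mx_word (u ++ rev w) = 1%:M.
  apply: mx_word_ker; first by rewrite all_cat un all_rev.
  by rewrite perm_word_cat uw -perm_word_cat perm_word_rev.
rewrite mx_word_cat => uw1; rewrite -[LHS]mulmx1 -(@mx_word_rev (rev w)) ?all_rev //.
by rewrite revK mx_word_cat mulmxA uw1 mul1mx.
Qed.

Lemma cox_repr_adj k : (k.+1 < n)%N -> cox_repr (adjtp n k) = A k.
Proof.
move=> kn; have := @cox_repr_word [:: k].
by rewrite /= kn /perm_word /mx_word /= mulg1 mulmx1 => ->.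
Qed.

Lemma cox_mx_repr : mx_repr [set: 'S_n] cox_repr.
Proof.
split=> [|g h _ _]; first exact: (@cox_repr_word [::]).
have [u un <-] := perm_wordP g; have [v vn <-] := perm_wordP h.
by rewrite -perm_word_cat !cox_repr_word ?mx_word_cat // all_cat un.
Qed.

Canonical cox_representation := MxRepresentation cox_mx_repr.

End CoxeterRepresentation.

(** * Young's orthogonal form *)

Lemma split_at2 (b : seq int) k : (k.+1 < size b)%N ->
  exists u x y v, b = u ++ x :: y :: v /\ size u = k.
Proof.
move=> kb; exists (take k b), (nth 0 b k), (nth 0 b k.+1), (drop k.+2 b).
by rewrite -!drop_nth ?cat_take_drop ?size_takel // ltnW // ltnW.
Qed.

(* Shapes are represented by their multisets of contents. *)
Definition tableaux (n : nat) (a : seq int) : seq (seq int) :=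
  [seq b <- lattices n n | perm_eq a b].

Lemma mem_tableaux n a b :
  (b \in tableaux n a) = [&& size b == n, lattice b & perm_eq a b].
Proof. by rewrite mem_filter mem_lattices // andbC andbA. Qed.

Lemma tableaux_uniq n a : uniq (tableaux n a).
Proof. exact/filter_uniq/lattices_uniq. Qed.

Lemma size_tableaux n a : size (tableaux n a) = ntableaux n n a.
Proof. exact: size_filter. Qed.

Lemma tableaux_swap n a u x y v : y != x + 1 -> y != x - 1 ->
  (u ++ x :: y :: v \in tableaux n a) = (u ++ y :: x :: v \in tableaux n a).
Proof.
move=> yx1 yx2; rewrite !mem_tableaux (lattice_swap _ _ yx1 yx2) !size_cat /=.
congr [&& _, _ & _]; apply: permPr; rewrite perm_cat2l.
by apply/seq.permP => p /=; lia.
Qed.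

Section OrthogonalForm.

Variables (F : numClosedFieldType) (n : nat) (a : seq int).

Local Notation L := (tableaux n a).
Local Notation d := (size L).

(** The basis vector of [b], and 0 when [b] is not a tableau of this shape, which frees the
    identities below from side conditions. *)
Definition tvec (b : seq int) : 'rV[F]_d := \row_j (nth [::] L j == b)%:R.

(** The inverse axial distance. Of the root [scoef], only its square and its symmetry in [x] and [y]
    are used in the relations. *)
Definition rcoef (x y : int) : F := ((y - x)%:~R)^-1.
Definition scoef (x y : int) : F := sqrtC (1 - rcoef x y ^+ 2).

Definition swap (k : nat) (b : seq int) : seq int :=
  take k b ++ [:: nth 0 b k.+1, nth 0 b k & drop k.+2 b].

(* Unlike in the seminormal form, both off-diagonal coefficients vanish when the
   swap leads out of the standard tableaux. *)
Definition adj_mx (k : nat) : 'M[F]_d :=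
  \matrix_(i < d) (let b := nth [::] L i in
    let x := nth 0 b k in let y := nth 0 b k.+1 in
    rcoef x y *: tvec b + scoef x y *: tvec (swap k b)).

Lemma swap_cat u x y v : swap (size u) (u ++ x :: y :: v) = u ++ y :: x :: v.
Proof.
rewrite /swap take_size_cat // !nth_cat ltnNge leqnSn ltnn subSnn subnn /=.
by rewrite drop_cat ltnNge leqW //= -addn2 addKn /= ?drop0.
Qed.

Lemma rcoefN x y : rcoef y x = - rcoef x y.
Proof. by rewrite /rcoef -opprB rmorphN invrN. Qed.

Lemma scoefC x y : scoef y x = scoef x y.
Proof. by rewrite /scoef rcoefN sqrrN. Qed.

Lemma scoef2 x y : scoef x y ^+ 2 = 1 - rcoef x y ^+ 2.
Proof. exact: sqrtCK. Qed.

Lemma rcoef2_eq1 x y : rcoef x y ^+ 2 = 1 -> y = x + 1 \/ y = x - 1.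
Proof.
move=> /eqP; rewrite sqrf_eq1 /rcoef => /orP[] /eqP/(congr1 GRing.inv).
  by rewrite invrK invr1 -[1 in RHS]/(1%:~R) => /intr_inj; lia.
rewrite invrK invrN invr1 -[1 in RHS]/(1%:~R) -rmorphN => /intr_inj; lia.
Qed.

Lemma scoef_eq0 x y : (scoef x y == 0) = (y == x + 1) || (y == x - 1).
Proof.
rewrite -sqrf_eq0 scoef2 subr_eq0 eq_sym; apply/eqP/orP.
  by move=> /rcoef2_eq1[] ->; rewrite eqxx; [left|right].
case=> /eqP ->; rewrite /rcoef addrAC subrr add0r; first by rewrite invr1 expr1n.
by rewrite rmorphN invrN sqrrN invr1 expr1n.
Qed.

Lemma tvec_out b : b \notin L -> tvec b = 0.
Proof.
move=> bL; apply/rowP => j; rewrite !mxE; case: eqP => // bj.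
by rewrite -bj mem_nth in bL.
Qed.

Lemma tvec_nth (j : 'I_d) : tvec (nth [::] L j) = delta_mx 0 j.
Proof.
apply/rowP => k; rewrite !mxE eqxx /= nth_uniq ?tableaux_uniq //.
Qed.

Lemma mem_tableaux_nth b : b \in L -> exists j : 'I_d, b = nth [::] L j.
Proof.
by move=> bL; exists (Ordinal (introT idP (etrans (index_mem b L) bL))); rewrite /= nth_index.
Qed.

(** Valid for every sequence: if exactly one of the two is a tableau, then [y] is [x + 1] or [x - 1]
    and [scoef x y] vanishes. *)
Lemma tvec_adj u x y v :
  tvec (u ++ x :: y :: v) *m adj_mx (size u) =
  rcoef x y *: tvec (u ++ x :: y :: v) + scoef x y *: tvec (u ++ y :: x :: v).
Proof.
have [bL|bL] := boolP (u ++ x :: y :: v \in L).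
  have [j def_j] := mem_tableaux_nth bL.
  rewrite {1}def_j tvec_nth -rowE rowK /= -def_j swap_cat.
  by rewrite !nth_cat ltnn subnn (ltnNge _.+1) leqnSn subSnn.
rewrite tvec_out // mul0mx scaler0 add0r.
have [->|] := eqVneq (scoef x y) 0; first by rewrite scale0r.
rewrite scoef_eq0 negb_or => /andP[yx1 yx2].
by rewrite tvec_out ?scaler0 // -tableaux_swap.
Qed.

Lemma tvec_eq m (X Y : 'M[F]_(d, m)) :
  (forall b, b \in L -> tvec b *m X = tvec b *m Y) -> X = Y.
Proof.
move=> XY; apply/row_matrixP => j; rewrite !rowE -tvec_nth.
by apply: XY; apply: mem_nth.
Qed.

Lemma adj_mx_inv k : (k.+1 < n)%N -> adj_mx k *m adj_mx k = 1%:M.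
Proof.
move=> kn; apply: tvec_eq => b; rewrite mem_tableaux => /and3P[/eqP bn _ _].
have [|u [x [y [v [-> <-]]]]] := @split_at2 b k; first by rewrite bn.
rewrite mulmx1 mulmxA tvec_adj mulmxDl -!scalemxAl !tvec_adj.
move: (tvec _) (tvec _) => s t; apply/rowP => j; rewrite !mxE (rcoefN x y) (scoefC x y).
have := scoef2 x y; move: (rcoef x y) (scoef x y) => p P P2.
rewrite -[RHS]mul1r -[in RHS](subrK (p ^+ 2) 1) -P2; ring.
Qed.

(** For a = y - x and b = z - y this reads 1/(ab) = (1/(a+b)) (1/a + 1/b). *)
Lemma rcoef_braid x y z : x != y -> y != z -> x != z ->
  rcoef x y * rcoef y z = rcoef x z * (rcoef x y + rcoef y z).
Proof.
have E s t : s != t -> (t%:~R - s%:~R != 0 :> F) by rewrite subr_eq0 eqr_int eq_sym.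
move=> /E xy /E yz /E xz; rewrite /rcoef !rmorphB /=; field.
by rewrite xy yz xz.
Qed.

Lemma adj_mx_braid k : (k.+2 < n)%N ->
  adj_mx k *m adj_mx k.+1 *m adj_mx k = adj_mx k.+1 *m adj_mx k *m adj_mx k.+1.
Proof.
move=> kn; apply: tvec_eq => b; rewrite mem_tableaux => /and3P[/eqP bn bP _].
have [|u [x [y [[|z v] [def_b def_k]]]]] := @split_at2 b k; first by rewrite bn ltnW.
  by move: bn; rewrite def_b size_cat /= def_k; lia.
have adj1 s t w := tvec_adj u s t w; rewrite def_k in adj1.
have adj2 r s t w : tvec (u ++ r :: s :: t :: w) *m adj_mx k.+1 =
    rcoef s t *: tvec (u ++ r :: s :: t :: w) + scoef s t *: tvec (u ++ r :: t :: s :: w).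
  by rewrite -!(cat_rcons r u) -tvec_adj size_rcons def_k.
have xy : x != y by apply: (@lattice_neq1 u _ _ (z :: v)); rewrite -def_b.
have xz : x != z by apply: (@lattice_neq2 u _ y _ v); rewrite -def_b.
have yz : y != z by apply: (@lattice_neq1 (rcons u x) _ _ v); rewrite cat_rcons -def_b.
rewrite def_b !mulmxA !(adj1, adj2, mulmxDl, =^~ scalemxAl).
(* The vectors of the six arrangements of x, y, z become unknowns; the identity does not depend on
   which of them vanish. *)
move: (tvec _) (tvec _) (tvec _) (tvec _) (tvec _) (tvec _) => t1 t2 t3 t4 t5 t6.
apply/rowP => j; rewrite !mxE.
rewrite !(rcoefN x y, rcoefN y z, rcoefN x z, scoefC x y, scoefC y z, scoefC x z).
have := rcoef_braid xy yz xz; have := scoef2 x y; have := scoef2 y z.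
move: (rcoef x y) (rcoef y z) (rcoef x z) (scoef x y) (scoef y z) (scoef x z).
move=> p q s P Q S.
move=> Q2 P2 pqs; apply/eqP; rewrite -subr_eq0; apply/eqP.
(* The difference of the two sides, written as a combination of the three relations between the
   coefficients. *)
transitivity (((p - q) * (p * q - s * (p + q)) + s * (P ^+ 2 - (1 - p ^+ 2))
    - s * (Q ^+ 2 - (1 - q ^+ 2))) * t6 0 j
  + P * (p * q - s * (p + q)) * t5 0 j - Q * (p * q - s * (p + q)) * t4 0 j).
  by ring.
by rewrite Q2 P2 pqs !subrr !(mulr0, mul0r, addr0, subr0).
Qed.

Lemma adj_mxC j k : (j.+1 < k)%N -> (k.+1 < n)%N ->
  adj_mx j *m adj_mx k = adj_mx k *m adj_mx j.
Proof.
move=> jk kn; apply: tvec_eq => b; rewrite mem_tableaux => /and3P[/eqP bn _ _].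
have [|u [x [y [v [def_b def_j]]]]] := @split_at2 b j; first by rewrite bn; lia.
have [|v' [z [t [w [def_v def_k]]]]] := @split_at2 v (k - j.+2)%N.
  by move: bn; rewrite def_b size_cat /= def_j; lia.
have adj1 p q r := tvec_adj u p q r; rewrite def_j in adj1.
have adj2 p q r s : tvec (u ++ p :: q :: v' ++ r :: s :: w) *m adj_mx k =
    rcoef r s *: tvec (u ++ p :: q :: v' ++ r :: s :: w) +
    scoef r s *: tvec (u ++ p :: q :: v' ++ s :: r :: w).
  have <- : size (u ++ p :: q :: v') = k by rewrite size_cat /= def_j def_k; lia.
  have E e f : u ++ p :: q :: v' ++ e :: f :: w = (u ++ p :: q :: v') ++ e :: f :: w.
    by rewrite -catA.
  by rewrite !E tvec_adj.
rewrite def_b def_v !mulmxA !(adj1, adj2, mulmxDl, =^~ scalemxAl).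
move: (tvec _) (tvec _) (tvec _) (tvec _) => t1 t2 t3 t4.
by apply/rowP => r; rewrite !mxE; ring.
Qed.

Definition orth_repr := cox_representation adj_mx_inv adj_mx_braid adj_mxC.

Lemma orth_repr_adj k : (k.+1 < n)%N -> orth_repr (adjtp n k) = adj_mx k.
Proof. exact: (cox_repr_adj adj_mx_inv adj_mx_braid adj_mxC). Qed.

End OrthogonalForm.

(* The image of X_(k+1), because X_(k+2) = s X_(k+1) s + s for s = s_(k+1). *)
Fixpoint jm_mx (F : fieldType) d (A : nat -> 'M[F]_d) (k : nat) : 'M[F]_d :=
  if k is k'.+1 then A k' *m jm_mx A k' *m A k' + A k' else 0.

(** On [b] and its swap the previous Jucys-Murphy matrix has eigenvalues x and y. Conjugating by the
    transposition and adding it gives y on [b], by r (y - x) = 1 and P^2 = 1 - r^2 for the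
    coefficients r, P of the orthogonal form. *)
Lemma tvec_jm (F : numClosedFieldType) n a b k : (k < n)%N ->
  tvec F n a b *m jm_mx (@adj_mx F n a) k = (nth 0 b k)%:~R *: tvec F n a b.
Proof.
have [|bL] := boolP (b \in tableaux n a); last first.
  by move=> _; rewrite tvec_out // mul0mx scaler0.
elim: k b => [|k IHk] b bL kn.
  rewrite mulmx0; move: bL; rewrite mem_tableaux.
  by case: b => [|x b] /and3P[_ bP _]; rewrite ?(lattice_head bP) scale0r.
have {}IHk c : tvec F n a c *m jm_mx (@adj_mx F n a) k = (nth 0 c k)%:~R *: tvec F n a c.
  have [cL|cL] := boolP (c \in tableaux n a); first exact: IHk (ltnW kn).
  by rewrite tvec_out // mul0mx scaler0.
have bn : size b = n by move: bL; rewrite mem_tableaux => /and3P[/eqP].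
have [|u [x [y [v [def_b def_k]]]]] := @split_at2 b k; first by rewrite bn.
have adj1 s t := tvec_adj F n a u s t v; rewrite def_k in adj1.
have nth1 s t : nth 0 (u ++ s :: t :: v) k = s by rewrite nth_cat def_k ltnn subnn.
have nth2 : nth 0 b k.+1 = y by rewrite def_b nth_cat def_k ltnNge leqnSn subSnn.
have bP : lattice b by move: bL; rewrite mem_tableaux => /and3P[].
have xy : x != y by apply: (@lattice_neq1 u _ _ v); rewrite -def_b.
rewrite nth2 def_b /= mulmxDr !mulmxA !(adj1, mulmxDl, IHk, nth1, =^~ scalemxAl).
rewrite (rcoefN F x y) (scoefC F x y).
have := scoef2 F x y; have : rcoef F x y * (y%:~R - x%:~R) = 1.
  by rewrite -rmorphB mulVf // intr_eq0 subr_eq0 eq_sym.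
move: (tvec _ _ _ _) (tvec _ _ _ _) (rcoef _ _ _) (scoef _ _ _) => s t p P pxy P2.
apply/rowP => j; rewrite !mxE; apply/eqP; rewrite -subr_eq0; apply/eqP.
transitivity ((- p * (p * (y%:~R - x%:~R) - 1) + (P ^+ 2 - (1 - p ^+ 2)) * y%:~R) * t 0 j
  - P * (p * (y%:~R - x%:~R) - 1) * s 0 j); first by ring.
by rewrite pxy P2 !subrr !(mulr0, mul0r, subr0, addr0).
Qed.

(** * Irreducibility and completeness *)

(** [r2] is a mere multiplicative function so as to cover a representation of 'S_n.+1 restricted
    along [lift_perm]. *)
Lemma repr_intertwine (F : fieldType) n m1 m2
    (r1 : mx_representation F [set: 'S_n] m1) (r2 : 'S_n -> 'M[F]_m2) (X : 'M_(m1, m2)) :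
  r2 1%g = 1%:M -> {morph r2 : g h / (g * h)%g >-> g *m h} ->
  (forall k, (k.+1 < n)%N -> r1 (adjtp n k) *m X = X *m r2 (adjtp n k)) ->
  forall g, r1 g *m X = X *m r2 g.
Proof.
move=> r21 r2M rX; elim/adjtp_ind => [|g k kn IHg].
  by rewrite repr_mx1 r21 mul1mx mulmx1.
by rewrite repr_mxM ?inE // r2M -mulmxA rX // !mulmxA IHg.
Qed.

Lemma jm_intertwine (F : fieldType) m1 m2 n A1 A2 (X : 'M[F]_(m1, m2)) k :
  (forall j, (j.+1 < n)%N -> A1 j *m X = X *m A2 j) -> (k < n)%N ->
  jm_mx A1 k *m X = X *m jm_mx A2 k.
Proof.
move=> AX; elim: k => [|k IHk] kn /=; first by rewrite mul0mx mulmx0.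
have {}IHk := IHk (ltnW kn).
by rewrite mulmxDl mulmxDr -!mulmxA AX // (mulmxA (jm_mx _ _)) IHk !mulmxA AX.
Qed.

(** The kernel of [X] is a submodule. Applied to differences, it shows that an intertwiner out of an
    irreducible module is determined by its value at one nonzero vector. *)
Lemma mx_irr_kernel0 (F : fieldType) (gT : finGroupType) (G : {group gT}) m p
    (rG : mx_representation F G m) (C : gT -> 'M[F]_p) (X : 'M_(m, p)) (v : 'rV_m) :
  mx_irreducible rG -> (forall g, g \in G -> rG g *m X = X *m C g) ->
  v != 0 -> v *m X = 0 -> X = 0.
Proof.
move=> [_ _ irrG] rX v0 vX; apply/eqP; rewrite -[X]mul1mx -sub_kermx; apply: irrG.
- apply/mxmoduleP => g Gg; apply/sub_kermxP.
  by rewrite -mulmxA rX // mulmxA mulmx_ker mul0mx.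
- exact: submx1.
by apply: contraNneq v0 => X0; rewrite -submx0 -X0; apply/sub_kermxP.
Qed.

Section OrthogonalRepresentation.

Variables (F : numClosedFieldType) (n : nat) (a : seq int).

Local Notation L := (tableaux n a).
Local Notation d := (size L).
Local Notation jm := (jm_mx (@adj_mx F n a)).

Lemma jm_diag k : (k < n)%N ->
  jm k = diag_mx (\row_j (nth 0 (nth [::] L j) k)%:~R).
Proof.
move=> kn; apply: tvec_eq => b bL; rewrite tvec_jm //.
apply/rowP => j; rewrite mul_mx_diag !mxE.
by case: eqP => [->|]; rewrite ?mul0r ?mulr0 ?mul1r ?mulr1.
Qed.

Lemma size_nth_tableaux (j : 'I_d) : size (nth [::] L j) = n.
Proof. by have := mem_nth [::] (ltn_ord j); rewrite mem_tableaux => /and3P[/eqP]. Qed.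

Lemma tableaux_nth_inj (i j : 'I_d) :
  (forall k, (k < n)%N -> nth 0 (nth [::] L i) k = nth 0 (nth [::] L j) k) -> i = j.
Proof.
move=> ij; apply/val_inj/eqP; rewrite /= -(nth_uniq [::] _ _ (tableaux_uniq n a)) //.
by apply/eqP/(@eq_from_nth _ 0); rewrite !size_nth_tableaux.
Qed.

Lemma jm_coef (v : 'rV[F]_d) k j : (k < n)%N ->
  (v *m jm k) 0 j = v 0 j * (nth 0 (nth [::] L j) k)%:~R.
Proof. by move=> kn; rewrite jm_diag // mul_mx_diag !mxE. Qed.

(** Any nonzero coordinate of [v] forces [c] to be the content sequence of its tableau, so two
    nonzero coordinates would belong to the same tableau. *)
Lemma weight_vector (c : nat -> F) (v : 'rV[F]_d) : v != 0 ->
  (forall k, (k < n)%N -> v *m jm k = c k *: v) ->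
  exists2 b, b \in L & (forall k, (k < n)%N -> c k = (nth 0 b k)%:~R) /\
    exists2 x, x != 0 & v = x *: tvec F n a b.
Proof.
move=> v0 vc; have [j vj] : exists j, v 0 j != 0 by apply/rV0Pn.
have cE i k : v 0 i != 0 -> (k < n)%N -> c k = (nth 0 (nth [::] L i) k)%:~R.
  move=> vi kn; apply: (mulfI vi); have := congr1 (fun w : 'rV_d => w 0 i) (vc k kn).
  by rewrite jm_coef // !mxE => ->; rewrite mulrC.
exists (nth [::] L j); first exact: mem_nth.
split=> [k kn|]; first exact: cE.
exists (v 0 j) => //; rewrite tvec_nth; apply/rowP => i; rewrite !mxE eqxx /=.
have [->|ij] := eqVneq i j; first by rewrite mulr1.
rewrite mulr0; apply/eqP; apply: contraNT ij => vi; apply/eqP/tableaux_nth_inj.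
by move=> k kn; apply: (@intr_inj F); rewrite -!cE.
Qed.

Hypotheses (aP : lattice a) (an : size a = n).

Lemma mem_tableaux_self : a \in L.
Proof. by rewrite mem_tableaux an eqxx aP perm_refl. Qed.

Lemma tvec_neq0 b : b \in L -> tvec F n a b != 0.
Proof.
move=> /mem_tableaux_nth[j ->]; rewrite tvec_nth.
by apply/eqP => /matrixP/(_ 0 j); rewrite !mxE !eqxx => /eqP; rewrite oner_eq0.
Qed.

Lemma tvec_connected (P : seq int -> Prop) :
  (forall u x y v, u ++ x :: y :: v \in L -> scoef F x y != 0 ->
     P (u ++ x :: y :: v) -> P (u ++ y :: x :: v)) ->
  forall b c, b \in L -> c \in L -> P b -> P c.
Proof.
move=> Pswap b c bL cL; have bc : adm_equiv b c.
  move: bL cL; rewrite !mem_tableaux => /and3P[_ bP ab] /and3P[_ cP ac].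
  by apply: lattice_adm_equiv => //; rewrite -(permPl ab).
elim: bc bL cL => [_ _ [u [x [y [v [-> -> yx1 yx2]]]]]||x y z xy IHxy yz IHyz] //.
  by move=> bL _; apply: Pswap; rewrite // scoef_eq0 negb_or yx1.
move=> xL zL; have yL : y \in L.
  move: xL; rewrite !mem_tableaux -(adm_equiv_lattice xy).
  by rewrite (permPr (adm_equiv_perm xy)) (perm_size (adm_equiv_perm xy)).
by move=> /(IHxy xL yL); apply: IHyz.
Qed.

Lemma orth_repr_irr : mx_irreducible (orth_repr F n a).
Proof.
split=> [||U modU _ U0]; first exact: mxmodule1.
  rewrite -mxrank_eq0 mxrank1 -lt0n.
  by have := mem_tableaux_self; case: (L).
have adjU (w : 'rV_d) k : (k.+1 < n)%N -> (w <= U -> w *m adj_mx F n a k <= U)%MS.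
  by move=> kn wU; rewrite -orth_repr_adj //; apply: mxmodule_trans; rewrite ?inE.
have jmU (w : 'rV_d) k : (k < n)%N -> (w <= U -> w *m jm k <= U)%MS.
  elim: k w => [|k IHk] w kn wU; first by rewrite mulmx0 sub0mx.
  by rewrite mulmxDr !mulmxA addmx_sub ?adjU ?IHk ?adjU // ltnW.
have [j] : exists j : 'I_d, (tvec F n a (nth [::] L j) <= U)%MS.
  have [w0 w0U wU] : exists2 w : 'rV_d, w != 0 & (w <= U)%MS.
    by have /rowV0Pn[w] := U0; exists w.
  have [m] := ubnP #|[set i | w0 0 i != 0]|.
  elim: m w0 w0U wU => // m IHm w w0 wU wm.
  have [j wj] : exists j, w 0 j != 0 by apply/rV0Pn.
  have [w_j|[i wi ij]] : w = w 0 j *: tvec F n a (nth [::] L j) \/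
      exists2 i, w 0 i != 0 & i != j.
  - have [[i /andP[wi ij]]|wN] := pselect (exists i, (w 0 i != 0) && (i != j)).
      by right; exists i.
    left; rewrite tvec_nth; apply/rowP => i; rewrite !mxE eqxx /=.
    have [->|ij] := eqVneq i j; first by rewrite mulr1.
    by rewrite mulr0; apply/eqP; apply: contra_notT wN => wi; exists i; rewrite wi.
  - by exists j; rewrite -(eqmx_scale (tvec F n a (nth [::] L j)) wj) -w_j.
  have [k [kn ijk]] : exists k, (k < n)%N /\
      nth 0 (nth [::] L i) k != nth 0 (nth [::] L j) k.
    apply: contrapT => /forallNP ijN; case/eqP: ij; apply: tableaux_nth_inj => k kn.
    by apply/eqP; apply: contrapT => /negP ?; apply: (ijN k).
  (* Subtracting the eigenvalue of tableau [j] kills coordinate [j], keeps coordinate [i] nonzero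
     and creates no new one: the support shrinks. *)
  have wE l : (w *m jm k - (nth 0 (nth [::] L j) k)%:~R *: w) 0 l =
      w 0 l * ((nth 0 (nth [::] L l) k)%:~R - (nth 0 (nth [::] L j) k)%:~R).
    by have := jm_coef w l kn; rewrite !mxE => ->; rewrite mulrBr [_ * w 0 l]mulrC.
  apply: (IHm (w *m jm k - (nth 0 (nth [::] L j) k)%:~R *: w)).
  - apply/rV0Pn; exists i; rewrite wE mulf_neq0 //.
    by rewrite subr_eq0 eqr_int.
  - by rewrite addmx_sub ?jmU // -scaleNr scalemx_sub.
  rewrite (cardsD1 j) inE wj add1n ltnS in wm; apply: leq_ltn_trans wm.
  apply/subset_leq_card/fintype.subsetP => l; rewrite !inE wE.
  rewrite mulf_eq0 negb_or subr_eq0 andbC => /andP[+ ->].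
  by rewrite andbT; apply: contraNneq => ->.
(* From one basis vector to all: at an admissible transposition the off-diagonal coefficient is
   invertible, so the swapped vector lies in [U] too. *)
move=> jU; have bU b : b \in L -> (tvec F n a b <= U)%MS.
  move=> bL; pose P c : Prop := (tvec F n a c <= U)%MS.
  suff Pswap u x y v : u ++ x :: y :: v \in L -> scoef F x y != 0 ->
      P (u ++ x :: y :: v) -> P (u ++ y :: x :: v).
    exact: (tvec_connected Pswap (mem_nth [::] (ltn_ord j)) bL jU).
  rewrite /P => uL xy uU.
  have un : size (u ++ x :: y :: v) = n by move: uL; rewrite mem_tableaux => /and3P[/eqP].
  have un2 : ((size u).+1 < n)%N.
    by rewrite -un size_cat /= -[X in (X < _)%N]addn1 ltn_add2l.
  rewrite -(eqmx_scale _ xy).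
  rewrite -[X in (X <= _)%MS](addKr (rcoef F x y *: tvec F n a (u ++ x :: y :: v))).
  by rewrite -tvec_adj addmx_sub ?adjU // eqmx_opp scalemx_sub.
by apply/row_subP => j'; rewrite rowE mulmx1 -tvec_nth; apply/bU/mem_nth.
Qed.

End OrthogonalRepresentation.

Section TableauMap.

Variables (F : numClosedFieldType) (n : nat) (a : seq int) (m : nat).
Variable f : seq int -> 'rV[F]_m.

Definition tvec_map : 'M[F]_(size (tableaux n a), m) :=
  \matrix_(i < size (tableaux n a)) f (nth [::] (tableaux n a) i).

Hypothesis f_out : forall b, b \notin tableaux n a -> f b = 0.

Lemma tvec_mapE b : tvec F n a b *m tvec_map = f b.
Proof.
have [/mem_tableaux_nth[j ->]|bL] := boolP (b \in tableaux n a).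
  by rewrite tvec_nth -rowE rowK.
by rewrite tvec_out // mul0mx f_out.
Qed.

Lemma tvec_map_adj (B : 'M_m) k : (k.+1 < n)%N ->
  (forall u x y v, size u = k ->
     f (u ++ x :: y :: v) *m B =
     rcoef F x y *: f (u ++ x :: y :: v) + scoef F x y *: f (u ++ y :: x :: v)) ->
  adj_mx F n a k *m tvec_map = tvec_map *m B.
Proof.
move=> kn fB; apply: tvec_eq => b; rewrite mem_tableaux => /and3P[/eqP bn _ _].
have [|u [x [y [v [-> uk]]]]] := @split_at2 b k; first by rewrite bn.
by rewrite !mulmxA -{1}uk tvec_adj mulmxDl -!scalemxAl !tvec_mapE fB.
Qed.

End TableauMap.

(** * The orthogonal forms are all the irreducible representations *)

Section Completeness.

Variables (F : numClosedFieldType) (n : nat).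

Lemma tableaux_perm a a' : perm_eq a a' -> tableaux n a =i tableaux n a'.
Proof. by move=> aa' b; rewrite !mem_tableaux (permPl aa'). Qed.

(** Both spaces have the same tableaux as basis; the dimensions are equal without being convertible,
    hence a matrix matching the basis vectors. *)
Lemma orth_rsim_perm a a' : perm_eq a a' -> mx_rsim (orth_repr F n a) (orth_repr F n a').
Proof.
move=> aa'; have out b : b \notin tableaux n a -> tvec F n a' b = 0.
  by move=> ba; rewrite tvec_out // -(tableaux_perm aa').
have out' b : b \notin tableaux n a' -> tvec F n a b = 0.
  by move=> ba; rewrite tvec_out // (tableaux_perm aa').
exists (tvec_map n a (tvec F n a')).
- by rewrite !size_tableaux (ntableaux_perm _ _ aa').
- apply/row_freeP; exists (tvec_map n a' (tvec F n a)); apply: tvec_eq => b _.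
  by rewrite mulmxA !tvec_mapE // mulmx1.
move=> g _; apply: (repr_intertwine (r2 := orth_repr F n a')) => [|g1 g2|k kn].
- exact: repr_mx1.
- by rewrite repr_mxM ?inE.
rewrite !orth_repr_adj //; apply: tvec_map_adj => // u x y v <-.
exact: tvec_adj.
Qed.

(** An isomorphism carries the weight [a] over, and the weights of the target are the tableaux of
    shape [a']. *)
Lemma orth_rsim_eq a a' : lattice a -> size a = n ->
  mx_rsim (orth_repr F n a) (orth_repr F n a') -> perm_eq a' a.
Proof.
move=> aP an [B _ Bfree rB].
have aL := mem_tableaux_self aP an.
have aB0 : tvec F n a a *m B != 0.
  apply: contraNneq (tvec_neq0 F aL) => aB0.
  by apply/eqP/(row_free_inj Bfree); rewrite aB0 mul0mx.
have [k kn|b bL [ab _]] := weight_vector (c := fun k => (nth 0 a k)%:~R) aB0.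
  rewrite -mulmxA -(@jm_intertwine _ _ _ n (@adj_mx F n a)) // => [|j jn].
    by rewrite mulmxA tvec_jm // scalemxAl.
  by rewrite -!orth_repr_adj // rB ?inE.
move: bL; rewrite mem_tableaux => /and3P[/eqP bn _ a'b].
suff -> : a = b by [].
apply: (@eq_from_nth _ 0) => [|k]; rewrite an // => kn.
by apply: (@intr_inj F); apply: ab.
Qed.

Lemma Sn_pcharF : ([pchar F]^'.-group [set: 'S_n])%g.
Proof. by apply/pgroupP => p _ _; rewrite inE /= pchar_num. Qed.

Lemma irr_orth m (rG : mx_representation F [set: 'S_n] m) : mx_irreducible rG ->
  exists a, [/\ lattice a, size a = n & mx_rsim (orth_repr F n a) rG].
Proof.
move=> irrG; pose sG := DecSocleType (regular_repr F [set: 'S_n]).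
have splitG : group_splitting_field F [set: 'S_n] by apply: group_closure_closed_field.
pose h a : sG := irr_comp sG (orth_repr F n a).
have Y_P a : a \in lattices n n -> lattice a /\ size a = n.
  by rewrite mem_lattices // => /andP[/eqP].
have h_rsim a : a \in lattices n n -> mx_rsim (orth_repr F n a) (irr_repr (h a)).
  by move=> /Y_P[aP an]; exact: (rsim_irr_comp_pchar sG Sn_pcharF (orth_repr_irr F aP an)).
have h_deg a : a \in lattices n n -> ntableaux n n a = irr_degree (h a).
  by move=> /h_rsim/mxrank_rsim <-; rewrite size_tableaux.
have h_eq a b : a \in lattices n n -> b \in lattices n n -> (h b == h a) = perm_eq a b.
  move=> aY bY; apply/eqP/idP => [hab|/orth_rsim_perm].
    have [bP bn] := Y_P b bY; apply: (orth_rsim_eq bP bn).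
    apply: mx_rsim_trans (h_rsim _ bY) _; rewrite hab.
    exact: mx_rsim_sym (h_rsim _ aY).
  by move=> /(irr_comp_rsim_pchar sG Sn_pcharF).
have [/hasP[a aY /eqP ha]|/hasPn no_a] :=
  boolP (has (fun a => h a == irr_comp sG rG) (lattices n n)).
  exists a; have [aP an] := Y_P a aY; split=> //.
  apply: mx_rsim_trans (h_rsim _ aY) _; rewrite ha.
  exact: mx_rsim_sym (rsim_irr_comp_pchar sG Sn_pcharF irrG).
set i0 := irr_comp sG rG in no_a.
(* [c i] counts the tableaux whose shape gives the component [i]: it is the degree of [i] if there
   is such a shape, and 0 otherwise. *)
pose c i := count (fun a => h a == i) (lattices n n).
have c_le i : (c i <= irr_degree i)%N.
  have [/hasP[a aY /eqP <-]|] := boolP (has (fun a => h a == i) (lattices n n)).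
    by rewrite -h_deg // /c (eq_in_count (fun b bY => h_eq a b aY bY)).
  by rewrite has_count -leqNgt leqn0 /c => /eqP ->.
have c0 : c i0 = 0%N by apply/eqP; rewrite -leqn0 leqNgt -has_count; apply/hasPn.
(* Both sides are n!: the left one as the dimension of the split semisimple group algebra, the right
   one as the sum of [ntableaux] over all tableaux, grouped by component. A component with [c] = 0
   would make the left side larger. *)
have: (\sum_i irr_degree (i : sG) ^ 2 = \sum_i irr_degree (i : sG) * c i)%N.
  rewrite (sum_irr_degree_pchar sG Sn_pcharF splitG) cardsT card_Sn.
  rewrite -(sum_ntableaux (leqnn n)) big_seq (eq_bigr _ h_deg) -big_seq.
  under [RHS]eq_bigr => i _ do rewrite /c -sum1_count big_distrr /=.
  rewrite (exchange_big_dep predT) //=; apply: eq_bigr => a _.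
  by rewrite (big_pred1 (h a)) ?muln1 // => i; rewrite eq_sym.
rewrite (bigD1 i0) // [RHS](bigD1 i0) //= c0 muln0 add0n => sums.
have: (irr_degree i0 ^ 2 <= 0)%N.
  rewrite -(leq_add2r (\sum_(i | i != i0) irr_degree (i : sG) ^ 2)) sums add0n.
  by apply: leq_sum => i _; rewrite -mulnn leq_mul2l c_le orbT.
by rewrite leqn0 expn_eq0 -leqn0 leqNgt irr_degree_gt0.
Qed.

End Completeness.

(** * Weights and branching multiplicities *)

Section Weights.

Variables (F : numClosedFieldType) (n m : nat).
Variable rG : mx_representation F [set: 'S_n] m.

(** Given by the recursion so that any intertwiner of the adjacent transpositions preserves weights;
    [jm_opE] identifies it with the sum of transpositions. *)
Definition jm_op : nat -> 'M[F]_m := jm_mx (fun k => rG (adjtp n k)).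

Definition weighted (v : 'rV[F]_m) (c : nat -> F) :=
  forall k, (k < n)%N -> v *m jm_op k = c k *: v.

Definition seq_weight (b : seq int) (k : nat) : F := (nth 0 b k)%:~R.

Lemma seq_weight_inj b b' : size b = n -> size b' = n ->
  (forall k, (k < n)%N -> seq_weight b k = seq_weight b' k) -> b = b'.
Proof.
move=> bn bn' bb'; apply: (@eq_from_nth _ 0) => [|k]; rewrite bn ?bn' // => kn.
by apply: (@intr_inj F); apply: bb'.
Qed.

Variables (a : seq int).
Hypothesis rGa : mx_rsim (orth_repr F n a) rG.

Lemma jm_model : exists B : 'M[F]_(m, size (tableaux n a)), row_free B /\
  forall k, (k < n)%N -> jm_op k *m B = B *m jm_mx (adj_mx F n a) k.
Proof.
have [B _ Bfree rB] := mx_rsim_sym rGa; exists B; split=> // k kn.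
by apply: (jm_intertwine (n := n)) => // j jn; rewrite rB ?inE // orth_repr_adj.
Qed.

Lemma weighted_model : exists B : 'M[F]_(m, size (tableaux n a)),
  row_free B /\ forall (v : 'rV_m) c k, (k < n)%N ->
    v *m jm_op k = c *: v <-> (v *m B) *m jm_mx (adj_mx F n a) k = c *: (v *m B).
Proof.
have [B [Bfree BJ]] := jm_model; exists B; split=> // v c k kn.
rewrite -mulmxA -BJ // mulmxA scalemxAl; split=> [->//|].
exact: (row_free_inj Bfree).
Qed.

Lemma exists_weighted b : b \in tableaux n a ->
  exists2 v, v != 0 & weighted v (seq_weight b).
Proof.
move=> bL; have [B _ Bfree rB] := rGa; exists (tvec F n a b *m B).
  by rewrite -(mul0mx _ B) (inj_eq (row_free_inj Bfree)) tvec_neq0.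
move=> k kn; rewrite -mulmxA -(@jm_intertwine _ _ _ n (adj_mx F n a)) //.
  by rewrite mulmxA tvec_jm // scalemxAl.
by move=> j jn; rewrite -orth_repr_adj // rB ?inE.
Qed.

Lemma weighted_line v w b : v != 0 -> size b = n ->
  weighted v (seq_weight b) -> weighted w (seq_weight b) -> exists x, w = x *: v.
Proof.
move=> v0 bn vb wb; have [B [Bfree BJ]] := weighted_model.
have [->|w0] := eqVneq w 0; first by exists 0; rewrite scale0r.
have lineP u : u != 0 -> weighted u (seq_weight b) ->
    exists2 x, x != 0 & u *m B = x *: tvec F n a b.
  move=> u0 ub.
  have uB0 : u *m B != 0 by rewrite -(mul0mx _ B) (inj_eq (row_free_inj Bfree)).
  have [k kn|b' b'L [bb' uB]] := weight_vector (c := seq_weight b) uB0.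
    exact/BJ/ub.
  suff <- : b' = b by [].
  apply/esym/seq_weight_inj => //.
  by move: b'L; rewrite mem_tableaux => /and3P[/eqP].
have [x x0 vB] := lineP v v0 vb; have [y _ wB] := lineP w w0 wb.
exists (y / x); apply: (row_free_inj Bfree).
by rewrite -scalemxAl vB wB scalerA divfK.
Qed.

(** The weight vectors include the images of the tableau basis under an isomorphism, hence span.
    This is phrased as the vanishing criterion applied to elements of GZ(n). *)
Lemma weighted_span p (M : 'M[F]_(m, p)) :
  (forall v b, b \in tableaux n a -> v != 0 -> weighted v (seq_weight b) -> v *m M = 0) ->
  M = 0.
Proof.
move=> M0; have [B dm Bfree rB] := rGa.
have Bfull : row_full B by rewrite /row_full (eqP Bfree) dm.
apply: (row_full_inj Bfull); rewrite mulmx0; apply: tvec_eq => b bL.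
rewrite mulmxA mulmx0; apply: (M0 _ b) => //.
  by rewrite -(mul0mx _ B) (inj_eq (row_free_inj Bfree)) tvec_neq0.
move=> k kn; rewrite -mulmxA -(@jm_intertwine _ _ _ n (adj_mx F n a)) //.
  by rewrite mulmxA tvec_jm // scalemxAl.
by move=> j jn; rewrite -orth_repr_adj // rB ?inE.
Qed.

End Weights.

Lemma size_rcons_take (b : seq int) n : size b = n.+1 -> b = rcons (take n b) (nth 0 b n).
Proof. by move=> bn; rewrite -take_nth ?bn // take_oversize ?bn. Qed.

Lemma perm_rcons_last (b : seq int) x y : perm_eq (rcons b x) (rcons b y) -> x = y.
Proof.
rewrite -!cats1 perm_cat2l => /perm_mem/(_ y); rewrite !inE eqxx => /eqP.
by [].
Qed.

Section RestrictedWeights.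

Variables (F : numClosedFieldType) (n m : nat).
Variable rG : mx_representation F [set: 'S_n.+1] m.
Variable a : seq int.
Hypothesis rGa : mx_rsim (orth_repr F n.+1 a) rG.

(* The last eigenvalue is forced, since [a] fixes the multiset of all of them. *)
Lemma restricted_weight v b : v != 0 -> size b = n ->
  (forall k, (k < n)%N -> v *m jm_op rG k = seq_weight F b k *: v) ->
  exists2 c, perm_eq (rcons b c) a & weighted rG v (seq_weight F (rcons b c)).
Proof.
move=> v0 bn vb; have [B [Bfree BJ]] := weighted_model rGa.
have vB0 : v *m B != 0 by rewrite -(mul0mx _ B) (inj_eq (row_free_inj Bfree)).
pose L := tableaux n.+1 a.
have L_rcons (j : 'I_(size L)) : (v *m B) 0 j != 0 ->
    nth [::] L j = rcons b (nth 0 (nth [::] L j) n).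
  move=> vj; have bj := size_nth_tableaux j.
  rewrite {1}(size_rcons_take bj); congr (rcons _ _).
  apply: (@eq_from_nth _ 0) => [|k]; first by rewrite size_take bj leqnn.
  rewrite size_take bj leqnn => kn; rewrite nth_take //.
  apply: (@intr_inj F); apply: (mulfI vj); rewrite -jm_coef; last exact: leqW.
  by have /(BJ _ _ _ (leqW kn)) -> := vb k kn; rewrite mxE mulrC.
have L_perm (j : 'I_(size L)) : perm_eq a (nth [::] L j).
  by have := mem_nth [::] (ltn_ord j); rewrite mem_tableaux => /and3P[].
have /rV0Pn[j vj] := vB0; exists (nth 0 (nth [::] L j) n).
  by rewrite -L_rcons // perm_sym.
move=> k; rewrite ltnS leq_eqVlt => /predU1P[->|kn]; last first.
  by rewrite vb // /seq_weight nth_rcons bn kn.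
apply/BJ => //; apply/rowP => i; rewrite jm_coef // [RHS]mxE mulrC /seq_weight.
rewrite nth_rcons bn ltnn eqxx.
have [->|vi] := eqVneq ((v *m B) 0 i) 0; first by rewrite !mulr0.
congr (_%:~R * _); apply: (@perm_rcons_last b).
by rewrite -!L_rcons // -(permPl (L_perm i)).
Qed.

End RestrictedWeights.

Lemma lift_adjtp n k : (k.+1 < n)%N ->
  lift_perm ord_max ord_max (adjtp n k) = adjtp n.+1 k.
Proof.
move=> kn; apply/permP => x; apply: val_inj => /=; rewrite (@adjtp_nat n.+1) 1?leqW //.
case: (unliftP ord_max x) => [y|] ->.
  rewrite lift_perm_lift !lift_max -adjtp_nat //.
by rewrite lift_perm_id /=; split_ifs; lia.
Qed.

(** Adding [c] raises the bit at [c] and lowers the one at [c + 1]; if both are bits before and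
    after, they were 01. *)
Lemma is_maya_addable a c : is_maya a -> is_maya (c :: a) -> curv a c = 1.
Proof.
move=> aM acM; rewrite curv_maya.
move: (aM c) (aM (c + 1)) (acM c) (acM (c + 1)); rewrite !maya_cons eqxx addrK eqxx.
by have [|_] := eqVneq c (c + 1); have [|_] := eqVneq c (c - 1); lia.
Qed.

(** * Branching multiplicities from weights *)

Section Branching.

Variables (F : numClosedFieldType) (n : nat) (V : irrep F n) (W : irrep F n.+1).

Lemma restr_homP B : reflect
  (forall g, V g *m B = B *m W (lift_perm ord_max ord_max g)) (B \in restr_hom V W).
Proof.
rewrite memvE; apply: (iffP subv_bigcapP) => BP g.
  have := BP g isT; rewrite -memvE memv_ker.
  by rewrite !lfun_simp /= => /eqP/subr0_eq.
by move=> _; rewrite -memvE memv_ker !lfun_simp /= BP subrr.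
Qed.

Lemma restr_hom_adj B :
  (forall k, (k.+1 < n)%N -> V (adjtp n k) *m B = B *m W (adjtp n.+1 k)) ->
  B \in restr_hom V W.
Proof.
move=> VB; apply/restr_homP; apply: repr_intertwine => [|g h|k kn].
- by rewrite lift_perm1 repr_mx1.
- by rewrite -(lift_permM _ ord_max) repr_mxM ?inE.
by rewrite lift_adjtp ?VB.
Qed.

Lemma restr_hom_weight B (v : 'rV_(irrep_dim V)) b : B \in restr_hom V W ->
  weighted V v (seq_weight F b) ->
  forall k, (k < n)%N -> (v *m B) *m jm_op W k = seq_weight F b k *: (v *m B).
Proof.
move=> /restr_homP VB vb k kn; rewrite -mulmxA.
rewrite -(@jm_intertwine _ _ _ n (fun k => V (adjtp n k))) //.
  by rewrite mulmxA vb // scalemxAl.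
by move=> j jn; rewrite VB lift_adjtp.
Qed.

Lemma irrepP : mx_irreducible V.
Proof. by case: V. Qed.

Lemma restr_hom_eq0 B (v : 'rV_(irrep_dim V)) : B \in restr_hom V W ->
  v != 0 -> v *m B = 0 -> B = 0.
Proof.
move=> /restr_homP VB.
apply: (mx_irr_kernel0 irrepP (C := fun g => W (lift_perm ord_max ord_max g))).
by move=> g _; apply: VB.
Qed.

Variables (a b : seq int).
Hypotheses (aP : lattice a) (an : size a = n) (Va : mx_rsim (orth_repr F n a) V).
Hypotheses (bP : lattice b) (bn : size b = n.+1) (Wb : mx_rsim (orth_repr F n.+1 b) W).

Lemma restr_hom_dim0 : (forall c, ~~ perm_eq (rcons a c) b) -> \dim (restr_hom V W) = 0%N.
Proof.
move=> ab; apply/eqP; rewrite dimv_eq0 -subv0; apply/subvP => B BV; rewrite memv0.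
have [v v0 va] := exists_weighted Va (mem_tableaux_self aP an).
apply/eqP/(restr_hom_eq0 BV v0)/eqP; apply: contraT => vB0.
have [c abc _] := restricted_weight Wb vB0 an (restr_hom_weight BV va).
by rewrite (negPf (ab c)) in abc.
Qed.

(** Appending [c] to the tableaux of shape [a] is an intertwiner, as the transpositions of 'S_n
    leave the last entry alone. It is unique up to scalars: its value at a vector of weight [a] lies
    on the line of weight [rcons a c] and determines it. *)
Lemma restr_hom_dim1 c : perm_eq (rcons a c) b -> \dim (restr_hom V W) = 1%N.
Proof.
move=> acb; have out d : d \notin tableaux n a -> tvec F n.+1 b (rcons d c) = 0.
  move=> dL; apply: tvec_out; apply: contra dL.
  rewrite !mem_tableaux size_rcons eqSS lattice_rcons => /and3P[-> /andP[-> _]] /=.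
  by rewrite -(permPl acb) -!cats1 perm_cat2r.
have [B _ Bfree VB] := mx_rsim_sym Va; have [C dC Cfree WC] := Wb.
have Bfull : row_full B by rewrite /row_full (eqP Bfree) (mxrank_rsim Va).
pose X := B *m tvec_map n a (fun d => tvec F n.+1 b (rcons d c)) *m C.
have XP : X \in restr_hom V W.
  apply: restr_hom_adj => k kn; rewrite !mulmxA VB ?inE // orth_repr_adj //.
  rewrite -!mulmxA -WC ?inE // orth_repr_adj ?leqW // !mulmxA -(mulmxA B).
  rewrite (tvec_map_adj out (B := adj_mx F n.+1 b k)) ?mulmxA // => u x y v uk.
  by rewrite !rcons_cat /= -uk tvec_adj.
have acL : rcons a c \in tableaux n.+1 b.
  rewrite mem_tableaux size_rcons an eqxx lattice_rcons aP perm_sym acb /= andbT.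
  rewrite (is_maya_addable (lattice_is_maya aP)) //.
  apply: perm_is_maya (lattice_is_maya bP); rewrite perm_sym.
  by apply: perm_trans acb; rewrite perm_sym perm_rcons.
have [v v0 va] := exists_weighted Va (mem_tableaux_self aP an).
have X0 : X != 0.
  rewrite -(mul0mx _ C) (inj_eq (row_free_inj Cfree)).
  rewrite -(mulmx0 _ B) (inj_eq (row_full_inj Bfull)).
  apply: contraNneq (tvec_neq0 F acL) => E; rewrite -(tvec_mapE out).
  by rewrite E mulmx0.
have ab_c e : perm_eq (rcons a e) b -> e = c.
  by move=> aeb; apply: (@perm_rcons_last a); rewrite (permPl aeb) perm_sym.
have vX0 : v *m X != 0 by apply: contraNneq X0 => /(restr_hom_eq0 XP v0) ->.
have lineP Y : Y \in restr_hom V W -> v *m Y != 0 ->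
    weighted W (v *m Y) (seq_weight F (rcons a c)).
  move=> YP vY0; have [e /ab_c ->] := restricted_weight Wb vY0 an (restr_hom_weight YP va).
  by [].
suff -> : restr_hom V W = <[X]>%VS by rewrite dim_vline X0.
apply/eqP; rewrite eqEsubv -memvE XP andbT; apply/subvP => Y YP.
have [vY0|vY0] := eqVneq (v *m Y) 0; first by rewrite (restr_hom_eq0 YP v0 vY0) mem0v.
have [|x vYX] := weighted_line Wb vX0 _ (lineP X XP vX0) (lineP Y YP vY0).
  by rewrite size_rcons an.
apply/vlineP; exists x; apply/eqP; rewrite -subr_eq0; apply/eqP.
apply: (restr_hom_eq0 _ v0); first by rewrite rpredB ?rpredZ.
by rewrite mulmxBr vYX -scalemxAr subrr.
Qed.

End Branching.

(** * Young diagrams *)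

(** The [k]-th box on the diagonal of content [c], counted from the border; one of the two maxima is
    0. *)
Definition box_at (c : int) (k : nat) : nat * nat :=
  ((k + absz (Num.max 0 (- c))%R)%N, (k + absz (Num.max 0 c)%R)%N).

Definition diag_index (x : nat * nat) : nat := minn x.1 x.2.

Definition contents (D : {fset nat * nat}) : seq int := [seq content x | x <- enum_fset D].

Lemma content_box_at c k : content (box_at c k) = c.
Proof. by rewrite /content /=; lia. Qed.

Lemma diag_index_box_at c k : diag_index (box_at c k) = k.
Proof. by rewrite /diag_index /=; lia. Qed.

Lemma box_at_content x : box_at (content x) (diag_index x) = x.
Proof. by case: x => i' j'; rewrite /box_at /content /diag_index /=; congr (_, _); lia. Qed.

Lemma downward_closed_mem (s : seq nat) k : uniq s ->
  (forall p q, (q <= p)%N -> p \in s -> q \in s) -> (k \in s) = (k < size s)%N.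
Proof.
move=> s_uniq s_down; apply/idP/idP => [ks|]; last apply: contraTT => ks.
  rewrite -(size_iota 0 k.+1); apply: uniq_leq_size; first exact: iota_uniq.
  by move=> p; rewrite mem_iota add0n ltnS => /s_down; apply.
rewrite -leqNgt -(size_iota 0 k); apply: uniq_leq_size => // p ps.
by rewrite mem_iota /= add0n ltnNge; apply: contra ks => /s_down; apply.
Qed.

(** The boxes of a diagram on one diagonal form an initial segment, so a diagram is determined by
    its diagonal lengths. *)
Lemma mem_diagram D x : is_diagram D ->
  (x \in D) = ((diag_index x)%:Z < mult (contents D) (content x)).
Proof.
move=> Ddiag; pose s := [seq diag_index y | y <- enum_fset D & content y == content x].
have mem_s k : (k \in s) = (box_at (content x) k \in D).
  apply/mapP/idP => [[y]|xD].
    by rewrite mem_filter => /andP[/eqP <- yD] ->; rewrite box_at_content.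
  exists (box_at (content x) k); last by rewrite diag_index_box_at.
  by rewrite mem_filter content_box_at eqxx.
have s_uniq : uniq s.
  rewrite map_inj_in_uniq ?filter_uniq ?fset_uniq // => y z.
  rewrite !mem_filter => /andP[/eqP yx _] /andP[/eqP zx _] yz.
  by rewrite -(box_at_content y) -(box_at_content z) yx zx yz.
have : mult (contents D) (content x) = (size s)%:Z.
  by rewrite /mult /contents count_map size_map size_filter.
move=> ->; rewrite ltz_nat -downward_closed_mem ?mem_s ?box_at_content // => p q qp.
rewrite !mem_s => pD; apply: Ddiag pD _ _; rewrite ?leq_add2r //.
Qed.

Lemma mult_le a b c d (e : nat) :
  (forall k : nat, (k + e)%:Z < mult a c -> k%:Z < mult b d) ->
  mult a c <= mult b d + e%:Z.
Proof.
by move=> ab; have := ab (absz (mult b d)); move: (mult_ge0 a c) (mult_ge0 b d); lia.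
Qed.

(** Moving a box one step left or up stays in the diagram and compares neighbouring diagonals; the
    shift [e] is 1 when this leads to the diagonal farther from the main one. *)
Lemma diagram_is_maya D : is_diagram D -> is_maya (contents D).
Proof.
move=> Ddiag c.
have le_mult c' d e : (forall k, (box_at d k).1 <= (box_at c' (k + e)).1)%N ->
    (forall k, (box_at d k).2 <= (box_at c' (k + e)).2)%N ->
    mult (contents D) c' <= mult (contents D) d + e%:Z.
  move=> le1 le2; apply: mult_le => k.
  have memD c0 l : (l%:Z < mult (contents D) c0) = (box_at c0 l \in D).
    by rewrite mem_diagram // content_box_at diag_index_box_at.
  by rewrite !memD => cD; apply: Ddiag cD (le1 k) (le2 k).
rewrite /maya; have [c0|c0] := ltP 0 c.
  have le1 : mult (contents D) c <= mult (contents D) (c - 1) + 0%N%:Z.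
    by apply: le_mult => k /=; lia.
  have le2 : mult (contents D) (c - 1) <= mult (contents D) c + 1%N%:Z.
    by apply: le_mult => k /=; lia.
  by lia.
have le1 : mult (contents D) (c - 1) <= mult (contents D) c + 0%N%:Z.
  by apply: le_mult => k /=; lia.
have le2 : mult (contents D) c <= mult (contents D) (c - 1) + 1%N%:Z.
  by apply: le_mult => k /=; lia.
by lia.
Qed.

Lemma diagram_eq D E : is_diagram D -> is_diagram E ->
  perm_eq (contents D) (contents E) -> D = E.
Proof.
by move=> Dd Ed /perm_mult DE; apply/fsetP => x; rewrite !mem_diagram // DE.
Qed.

Definition diagram_of (a : seq int) : {fset nat * nat} :=
  [fset x in [seq box_at c k | c <- a, k <- iota 0 (count_mem c a)]]%fset.

Lemma mem_diagram_of a x : (x \in diagram_of a) = ((diag_index x)%:Z < mult a (content x)).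
Proof.
rewrite !inE /mult ltz_nat; apply/allpairsPdep/idP => [[c [k [ca]]]|xa].
  by rewrite mem_iota add0n => /= ka ->; rewrite content_box_at diag_index_box_at.
exists (content x), (diag_index x); rewrite box_at_content mem_iota add0n; split=> //.
by rewrite -has_pred1 has_count; apply: leq_ltn_trans xa.
Qed.

Lemma diagram_of_diagram a : is_maya a -> is_diagram (diagram_of a).
Proof.
move=> aM.
have left i' j' : (i', j'.+1) \in diagram_of a -> (i', j') \in diagram_of a.
  rewrite !mem_diagram_of /diag_index /content /=.
  move: (aM (j'.+1%:Z - i'%:Z)); rewrite /maya.
  by have -> : j'.+1%:Z - i'%:Z - 1 = j'%:Z - i'%:Z; lia.
have up i' j' : (i'.+1, j') \in diagram_of a -> (i', j') \in diagram_of a.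
  rewrite !mem_diagram_of /diag_index /content /=.
  move: (aM (j'%:Z - i'%:Z)); rewrite /maya.
  by have -> : j'%:Z - i'.+1%:Z = j'%:Z - i'%:Z - 1; lia.
move=> p q p' q' pD /subnK pp /subnK qq; move: pD; rewrite -pp -qq.
elim: (p - p')%N => [|r IHr]; last by move=> /up.
by elim: (q - q')%N => [|r IHr] // /left.
Qed.

Lemma contents_diagram_of a : is_maya a -> perm_eq (contents (diagram_of a)) a.
Proof.
move=> aM; apply: mult_perm => c; apply/le_anti/andP.
have memD k : (k%:Z < mult (contents (diagram_of a)) c) = (k%:Z < mult a c).
  have := mem_diagram_of a (box_at c k); rewrite mem_diagram; last exact: diagram_of_diagram.
  by rewrite content_box_at diag_index_box_at.
by split; rewrite -[leRHS]addr0; apply: (mult_le (e := 0)) => k; rewrite addn0 memD.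
Qed.

Lemma size_contents D : size (contents D) = #|` D|%fset.
Proof. exact: size_map. Qed.

Lemma contents_fsetU1 x (D : {fset nat * nat}) : x \notin D ->
  perm_eq (contents (x |` D)%fset) (content x :: contents D).
Proof.
move=> xD; apply: (@perm_map _ _ content _ (x :: D)).
apply: uniq_perm; rewrite /= ?fset_uniq ?andbT //.
by move=> y; rewrite !inE.
Qed.

(** A box maximising row plus column index has no box of the diagram below it or to its right. *)
Lemma diagram_corner D : is_diagram D -> D != fset0 ->
  exists x E, [/\ is_diagram E, x \notin E & D = (x |` E)%fset].
Proof.
move=> Dd /fset0Pn[x0 x0D].
have [x xD xmax] : exists2 x, x \in D & forall y, y \in D -> (y.1 + y.2 <= x.1 + x.2)%N.
  have [[x xD] _ xmax] := arg_maxnP (P := predT) (i0 := [` x0D]%fset)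
    (fun y : D => (val y).1 + (val y).2)%N isT.
  by exists x => // y yD; apply: (xmax [` yD]%fset).
exists x, (D `\ x)%fset; rewrite fsetD1K // !inE eqxx; split=> //.
move=> p q p' q'; rewrite !inE => /andP[pqx pqD] pp qq; rewrite (Dd _ _ _ _ pqD) // andbT.
apply: contraNneq pqx => px; have := xmax _ pqD; rewrite -px /= => pq.
by apply/eqP; congr (_, _); lia.
Qed.

Lemma diagram_lattice D : is_diagram D ->
  exists2 a, lattice a & perm_eq a (contents D).
Proof.
have [m] := ubnP #|` D|%fset; elim: m D => // m IHm D Dm Dd.
have [->|D0] := eqVneq D fset0; first by exists [::].
have [x [E [Ed xE def_D]]] := diagram_corner Dd D0.
have [|a aP aE] := IHm E _ Ed.
  by move: Dm; rewrite def_D cardfsU1 xE.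
have Dx : perm_eq (contents D) (content x :: contents E).
  by rewrite def_D; apply: contents_fsetU1.
exists (rcons a (content x)).
  rewrite lattice_rcons aP (perm_curv aE) is_maya_addable //; first exact: diagram_is_maya.
  exact: perm_is_maya Dx (diagram_is_maya Dd).
by rewrite perm_rcons perm_sym (permPl Dx) perm_cons perm_sym.
Qed.

(** * Paths in the Young graph *)

Lemma gpath_eq (G : gradedGraph) n (P Q : gpath G n) : (forall i, P i = Q i) -> P = Q.
Proof.
case: P Q => [p pP] [q qP] /= pq.
have E : p = q by apply: functional_extensionality_dep.
by case: q / E qP {pq} => qP; congr GPath; apply: Prop_irrelevance.
Qed.

Lemma gpath_edge (G : gradedGraph) n (P : gpath G n) (i : 'I_n) :
  (0 < edges (P (edge_src i)) (P (edge_tgt i)))%N.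
Proof. by case: P. Qed.

Lemma diagramP n (D : diagram n) : is_diagram D.
Proof. by case: D => D /= /andP[/asboolP]. Qed.

Lemma card_diagram n (D : diagram n) : #|` D|%fset = n.
Proof. by case: D => D /= /andP[_ /eqP]. Qed.

Lemma diagram_inj n (D E : diagram n) : D = E :> {fset nat * nat} -> D = E.
Proof.
case: D E => [D DP] [E EP] /= DE; case: E / DE EP => EP.
by congr Diagram; apply: bool_irrelevance.
Qed.

Lemma skew_boxP (nu eta : {fset nat * nat}) :
  (nu `<=` eta)%fset -> #|` (eta `\` nu)%fset| == 1%N ->
  skew_box nu eta \notin nu /\ eta = (skew_box nu eta |` nu)%fset.
Proof.
move=> sub card1; have : skew_box nu eta \in (eta `\` nu)%fset.
  rewrite /skew_box; case E: (enum_fset (eta `\` nu)%fset) => [|y s].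
    by rewrite E in card1.
  by change (y \in enum_fset (eta `\` nu)%fset); rewrite E mem_head.
have /cardfs1P[x def_x] := card1; rewrite def_x inE => /eqP ->.
have : x \in (eta `\` nu)%fset by rewrite def_x inE.
rewrite inE => /andP[xnu _]; split=> //.
by rewrite -def_x fsetUC fsetUDl fsetDv fsetD0; apply/esym/fsetUidPr.
Qed.

Lemma skew_box_contents n (nu : diagram n) (eta : diagram n.+1) :
  (0 < edges (nu : young_graph n) (eta : young_graph n.+1))%N ->
  perm_eq (contents eta) (content (skew_box nu eta) :: contents nu).
Proof.
rewrite /= lt0b => /andP[sub /(skew_boxP sub)[xnu def_eta]].
by rewrite {1}def_eta contents_fsetU1.
Qed.

Lemma young_edge_contents n (nu : diagram n) (eta : diagram n.+1) c :
  perm_eq (c :: contents nu) (contents eta) ->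
  (0 < edges (nu : young_graph n) (eta : young_graph n.+1))%N.
Proof.
move=> /perm_mult nu_eta; have sub : (nu `<=` eta)%fset.
  apply/fsubsetP => x; rewrite !mem_diagram; try exact: diagramP.
  by move=> /lt_le_trans -> //; rewrite -nu_eta mult_cons; lia.
by rewrite /= lt0b sub /= cardfsDS // !card_diagram subSnn.
Qed.

Section PathWord.

Variable n : nat.
Implicit Types T : gpath young_graph n.

Definition path_word T : seq int :=
  [seq content (skew_box (T (edge_src i) : diagram _) (T (edge_tgt i) : diagram _))
    | i <- enum 'I_n].

Lemma size_path_word T : size (path_word T) = n.
Proof. by rewrite size_map size_enum_ord. Qed.

Lemma nth_path_word T (i : 'I_n) :
  nth 0 (path_word T) i =
  content (skew_box (T (edge_src i) : diagram _) (T (edge_tgt i) : diagram _)).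
Proof. by rewrite (nth_map i) ?size_enum_ord // nth_ord_enum. Qed.

Lemma content_vectorE (F : fieldType) T i :
  content_vector F T i = (nth 0 (path_word T) i)%:~R.
Proof. by rewrite ffunE nth_path_word. Qed.

Lemma path_word_take T (i : 'I_n.+1) :
  lattice (take i (path_word T)) /\
  perm_eq (take i (path_word T)) (contents (T i : diagram _)).
Proof.
have [m] : exists m, i = m :> nat by exists i.
elim: m i => [|m IHm] i im.
  have -> : contents (T i : diagram _) = [::].
    by apply: size0nil; rewrite size_contents card_diagram.
  by rewrite (_ : take i _ = [::]) //; rewrite im take0.
have mn : (m < n)%N by rewrite -ltnS -im ltn_ord.
have -> : i = edge_tgt (Ordinal mn) by apply: val_inj.
have [] := IHm (edge_src (Ordinal mn)) erefl.
set x := Ordinal mn; set D := T (edge_src x); set E := T (edge_tgt x).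
have edge : perm_eq (contents (E : diagram _))
    (content (skew_box (D : diagram _) (E : diagram _)) :: contents (D : diagram _)).
  exact: skew_box_contents (gpath_edge T x).
rewrite /= (take_nth 0) ?size_path_word // (nth_path_word T x) -/D -/E => aP aD.
split; last by rewrite perm_rcons perm_sym (permPl edge) perm_cons perm_sym.
rewrite lattice_rcons aP (perm_curv aD) is_maya_addable //.
  exact/diagram_is_maya/diagramP.
by apply: (perm_is_maya edge); apply: diagram_is_maya; apply: diagramP.
Qed.

Lemma path_word_lattice T : lattice (path_word T).
Proof. by have [] := path_word_take T ord_max; rewrite take_oversize ?size_path_word. Qed.

Lemma path_word_contents T : perm_eq (path_word T) (contents (T ord_max : diagram _)).
Proof. by have [_] := path_word_take T ord_max; rewrite take_oversize ?size_path_word. Qed.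

Lemma path_word_inj T T' : path_word T = path_word T' -> T = T'.
Proof.
move=> TT'; apply: gpath_eq => i; apply: diagram_inj; apply: diagram_eq; try exact: diagramP.
have [_ Ti] := path_word_take T i; have [_ T'i] := path_word_take T' i.
by rewrite -(permPl Ti) TT'.
Qed.

Lemma diagram_of_subproof (a : seq int) : lattice a ->
  `[< is_diagram (diagram_of a) >] && (#|` diagram_of a|%fset == size a).
Proof.
move=> /lattice_is_maya aM; apply/andP; split; first exact/asboolP/diagram_of_diagram.
by rewrite -size_contents (perm_size (contents_diagram_of aM)).
Qed.

Lemma lattice_path a : lattice a -> size a = n -> exists T, path_word T = a.
Proof.
move=> aP an; have takeP (i : 'I_n.+1) :
    `[< is_diagram (diagram_of (take i a)) >] && (#|` diagram_of (take i a)|%fset == i).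
  have := @diagram_of_subproof (take i a); rewrite size_takel; last by rewrite an -ltnS.
  by apply; move: aP; rewrite -{1}(cat_take_drop i a) lattice_cat => /andP[].
pose D (i : 'I_n.+1) : young_graph i := Diagram (takeP i).
have contD i : perm_eq (contents (D i : diagram _)) (take i a).
  apply: contents_diagram_of; apply: lattice_is_maya.
  by move: aP; rewrite -{1}(cat_take_drop i a) lattice_cat => /andP[].
have contS (i : 'I_n) : perm_eq (nth 0 a i :: contents (D (edge_src i) : diagram _))
    (contents (D (edge_tgt i) : diagram _)).
  rewrite (permPr (contD _)) /= (take_nth 0) ?an //.
  by rewrite perm_sym perm_rcons perm_cons perm_sym; apply: (contD (edge_src i)).
have DP (i : 'I_n) : (0 < edges (D (edge_src i)) (D (edge_tgt i)))%N.
  exact: young_edge_contents (contS i).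
exists (GPath DP); apply: (@eq_from_nth _ 0) => [|i]; rewrite size_path_word // => lt_i_n.
rewrite (nth_path_word _ (Ordinal lt_i_n)) /=.
have := contS (Ordinal lt_i_n).
rewrite (permPr (skew_box_contents (DP (Ordinal lt_i_n)))) => /perm_mult E.
have := congr1 (fun m => m (nth 0 a i)) E; rewrite /= !mult_cons eqxx /=.
by case: eqP => //; lia.
Qed.

End PathWord.

(** * Content vectors *)

Definition ffun_of_seq (F : fieldType) n (a : seq int) : {ffun 'I_n -> F} :=
  [ffun k : 'I_n => (nth 0 a k)%:~R].

Lemma mult_gt0 a c : (0 < mult a c) = (c \in a).
Proof. by rewrite lt0r mult_eq0 negbK mult_ge0 andbT. Qed.

(* Between two occurrences of [x] the maya bits at [x] and [x + 1] change from
   10 to 01. *)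
Lemma lattice_between u x v w : lattice (u ++ x :: v ++ x :: w) ->
  x - 1 \in v /\ x + 1 \in v.
Proof.
rewrite -[u ++ _]cat_rcons catA -[_ ++ x :: w]cat_rcons lattice_cat lattice_rcons.
case/andP=> /andP[uvP uvx] _; have uP : lattice (rcons u x).
  by move: uvP; rewrite lattice_cat => /andP[].
have uM := lattice_is_maya (proj1 (andP (etrans (esym (lattice_rcons u x)) uP))).
have uxM := lattice_is_maya uP; have uvM := lattice_is_maya uvP.
move: uP uvx; rewrite lattice_rcons !curv_maya => /andP[_ ux] uvx.
move: ux uvx (uM x) (uM (x + 1)) (uvM x) (uvM (x + 1)).
rewrite -!mult_gt0 /maya !addrK -!cats1 !mult_cat !mult_cons /mult /= eqxx.
have -> : (x == x - 1) = false by lia.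
have -> : (x == x + 1) = false by lia.
by rewrite -!/(mult _ _); move: (mult_ge0 v x); lia.
Qed.

(** The term of [curv] at 0 cannot account for the curvature alone: a nonempty sequence starts with
    0, so [x = 0] already occurs and weighs -2. *)
Lemma lattice_neighbour u x : lattice (rcons u x) -> u != [::] ->
  (x - 1 \in u) || (x + 1 \in u).
Proof.
rewrite lattice_rcons => /andP[uP ux] u0.
have u_0 : (x == 0) ==> (x \in u).
  case: u uP u0 {ux} => // y u /lattice_head -> _.
  by apply/implyP => /eqP ->; rewrite mem_head.
move: ux u_0; rewrite -!mult_gt0 /curv.
move: (mult_ge0 u x) (mult_ge0 u (x - 1)) (mult_ge0 u (x + 1)).
by case: (x == 0) => /=; lia.
Qed.

Lemma seq_split_nth (a : seq int) k : (k < size a)%N ->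
  exists v, a = take k a ++ nth 0 a k :: v.
Proof. by move=> ka; exists (drop k.+1 a); rewrite -drop_nth // cat_take_drop. Qed.

Lemma lattice_take a k : lattice a -> lattice (take k a).
Proof. by rewrite -{1}(cat_take_drop k a) lattice_cat => /andP[]. Qed.

Lemma lattice_take_nth a k : lattice a -> (k < size a)%N ->
  lattice (rcons (take k a) (nth 0 a k)).
Proof. by move=> aP ka; rewrite -take_nth //; apply: lattice_take. Qed.

Section ContLattice.

Variables (F : numClosedFieldType) (n : nat).

Lemma ffun_of_seq_inj a b : size a = n -> size b = n ->
  ffun_of_seq F n a = ffun_of_seq F n b -> a = b.
Proof.
move=> an bn ab; apply: (@eq_from_nth _ 0) => [|k]; rewrite an // => kn.
have := congr1 (fun f : {ffun _ -> F} => f (Ordinal kn)) ab.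
by rewrite !ffunE => /intr_inj.
Qed.

Lemma lattice_Cont a : lattice a -> size a = n -> Cont F n (ffun_of_seq F n a).
Proof.
move=> aP an; split=> [p p0|q q0|p q pq].
- rewrite ffunE p0; case: a aP {an} => //= x a /lattice_head -> //.
- have qa : (q < size a)%N by rewrite an.
  have near x : x \in take q a ->
      exists2 p : 'I_n, (p < q)%N & ffun_of_seq F n a p = x%:~R.
    move=> /(nthP 0)[p]; rewrite size_takel ?(ltnW qa) // => pq <-.
    exists (Ordinal (ltn_trans pq (ltn_ord q))) => //.
    by rewrite ffunE nth_take.
  have := lattice_neighbour (lattice_take_nth aP qa).
  rewrite -size_eq0 size_takel ?(ltnW qa) // -lt0n => /(_ q0)/orP[] /near[p pq ap].
    by exists p => //; left; rewrite ap rmorphB ffunE.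
  by exists p => //; right; rewrite ap rmorphD ffunE.
rewrite !ffunE => /intr_inj apq.
have qa : (q < size a)%N by rewrite an.
have [w def_a] := seq_split_nth qa; set x := nth 0 a q in apq def_a.
have [|v def_u] := @seq_split_nth (take q a) p; first by rewrite size_takel ?(ltnW qa).
rewrite take_takel ?(ltnW pq) // nth_take // apq in def_u.
have [] := @lattice_between (take p a) x v w.
  suff -> : take p a ++ x :: v ++ x :: w = a by [].
  by rewrite [RHS]def_a def_u -catA.
have up : size (take p a) = p by rewrite size_takel // ltnW // (ltn_trans pq).
have vq : (p + (size v).+1)%N = q.
  by have := congr1 size def_u; rewrite size_cat up size_takel ?(ltnW qa).
have near y : y \in v ->
    exists2 r : 'I_n, (p < r < q)%N & ffun_of_seq F n a r = y%:~R.
  move=> /(nthP 0)[r rv <-]; have rq : (p + r.+1 < q)%N by rewrite -vq ltn_add2l.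
  exists (Ordinal (ltn_trans rq (ltn_ord q))); first by rewrite /= rq andbT addnS ltnS leq_addr.
  rewrite ffunE /= -(nth_take 0 rq) def_u nth_cat up ltnNge leq_addr /=.
  by rewrite addKn.
move=> /near[r1 pr1 ar1] /near[r2 pr2 ar2]; split.
  by exists r1 => //; rewrite ar1 rmorphB ?ffunE ?apq.
by exists r2 => //; rewrite ar2 rmorphD ?ffunE ?apq.
Qed.

(** The entries are a priori in [F], but the first is 0 and each other one differs by 1 from an
    earlier one. *)
Lemma Cont_int c : Cont F n c -> exists a, size a = n /\ c = ffun_of_seq F n a.
Proof.
move=> [c0 c1 _]; have c_int (k : 'I_n) : exists z : int, c k = z%:~R.
  case: k => k; elim/ltn_ind: k => k IHk kn.
  case: (posnP k) => [k0|k0]; first by exists 0; rewrite c0.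
  have [p pk cp] := c1 (Ordinal kn) k0; have [z cz] := IHk p pk (ltn_ord p).
  have {cz} : c p = z%:~R by rewrite -cz; congr (c _); apply: val_inj.
  move=> cz; case: cp => cp; [exists (z + 1)|exists (z - 1)].
    by rewrite rmorphD /= -cz cp subrK.
  by rewrite rmorphB /= -cz cp addrK.
have [z cz] := choice c_int; exists [seq z k | k <- enum 'I_n].
split; first by rewrite size_map size_enum_ord.
by apply/ffunP => k; rewrite ffunE (nth_map k) ?size_enum_ord // nth_ord_enum.
Qed.

(** Only the lower bound on the curvature at the new entry [x] is at stake. If [x] occurred before,
    its curvature was -1 after the last occurrence, and condition (3) supplies both neighbours
    since; otherwise condition (2) supplies one neighbour, or [x] is the initial 0. *)
Lemma Cont_lattice a : size a = n -> Cont F n (ffun_of_seq F n a) -> lattice a.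
Proof.
move=> an [c0 c1 c2].
suff take_lat k : (k <= n)%N -> lattice (take k a).
  by have := take_lat n (leqnn n); rewrite take_oversize ?an.
elim: k => [|k IHk] kn; first by rewrite take0.
have {}IHk := IHk (ltnW kn); have ka : (k < size a)%N by rewrite an.
rewrite (take_nth 0) // lattice_rcons IHk /=; set b := take k a; pose x : int := nth 0 a k.
rewrite -/x.
have bM := lattice_is_maya IHk.
have size_b : size b = k by rewrite size_takel // ltnW.
suff le_bx : 1 <= curv b x.
  by have /andP[_ ge_bx] := is_maya_curv x bM; rewrite eq_le ge_bx.
have [xb|xb] := boolP (x \in b).
  have [u [v [def_b xv]]] := mem_split_last xb.
  have uk : (size u < k)%N by rewrite -size_b def_b size_cat /=; lia.
  have b_nth r : (r < k)%N -> nth 0 a r = nth 0 (u ++ x :: v) r.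
    by move=> rk; rewrite -def_b nth_take.
  have axu : nth 0 a (size u) = x by rewrite b_nth // nth_cat ltnn subnn.
  have near (r : 'I_n) : (size u < r < k)%N -> nth 0 a r \in v.
    case/andP=> ur rk; rewrite b_nth // nth_cat ltnNge (ltnW ur) /=.
    have -> : (r - size u)%N = (r - (size u).+1).+1 by lia.
    by apply: mem_nth; move: size_b; rewrite def_b size_cat /=; lia.
  have [|[r1 kr1 ar1] [r2 kr2 ar2]] := c2 (Ordinal (ltn_trans uk kn)) (Ordinal kn) uk.
    by rewrite !ffunE /= axu.
  have x1v : x - 1 \in v.
    suff -> : x - 1 = nth 0 a r1 by apply: near.
    move: ar1; rewrite !ffunE /= axu => ar1.
    by apply: (@intr_inj F); rewrite ar1 rmorphB.
  have x2v : x + 1 \in v.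
    suff -> : x + 1 = nth 0 a r2 by apply: near.
    move: ar2; rewrite !ffunE /= axu => ar2.
    by apply: (@intr_inj F); rewrite ar2 rmorphD.
  have ux : curv u x = 1.
    by move: IHk; rewrite -/b def_b lattice_cat /= => /and3P[_ /eqP].
  move: ux x1v x2v xv; rewrite -mult_eq0 -!mult_gt0 def_b /curv !mult_cat !mult_cons eqxx.
  have -> : (x == x - 1) = false by lia.
  have -> : (x == x + 1) = false by lia.
  by lia.
move: xb; rewrite -mult_eq0 /curv => /eqP ->.
have [k0|k0] := posnP k.
  have -> : x = 0 by apply: (@intr_inj F); have := c0 (Ordinal kn) k0; rewrite ffunE.
  rewrite eqxx; move: (mult_ge0 b (0 - 1)) (mult_ge0 b (0 + 1)).
  by move: (mult b _) (mult b _) => s t; lia.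
have [p pk ap] := c1 (Ordinal kn) k0.
have pb : nth 0 a p \in b by rewrite -(nth_take 0 pk) mem_nth // size_b.
move: (mult_ge0 b (x - 1)) (mult_ge0 b (x + 1)).
have [ap1|ap1] : nth 0 a p = x - 1 \/ nth 0 a p = x + 1.
- by move: ap; rewrite !ffunE => -[] ap; [left|right]; apply: (@intr_inj F);
    rewrite ap ?rmorphB ?rmorphD.
- by move: pb; rewrite ap1 -mult_gt0; lia.
by move: pb; rewrite ap1 -mult_gt0; lia.
Qed.

Lemma admissible_step_seq a c : size a = n -> admissible_step (ffun_of_seq F n a) c ->
  exists2 b, c = ffun_of_seq F n b & adm_step a b.
Proof.
move=> an [k [l [lk akl1 akl2 ->]]].
have kn : (k.+1 < size a)%N by rewrite an -lk.
have [u [x [y [v [def_a uk]]]]] := split_at2 kn.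
exists (u ++ y :: x :: v); last first.
  exists u, x, y, v; split=> //; apply/eqP => xy.
    apply: akl1; rewrite !ffunE lk def_a !nth_cat uk ltnn subnn (ltnNge _.+1) leqnSn subSnn /=.
    by rewrite xy rmorphD.
  apply: akl2; rewrite !ffunE lk def_a !nth_cat uk ltnn subnn (ltnNge _.+1) leqnSn subSnn /=.
  by rewrite xy rmorphB.
apply/ffunP => i'; rewrite !ffunE def_a; congr (_ %:~R).
case: tpermP => [->|->|/eqP + /eqP].
- by rewrite lk !nth_cat uk ltnn subnn (ltnNge _.+1) leqnSn subSnn.
- by rewrite lk !nth_cat uk ltnn subnn (ltnNge _.+1) leqnSn subSnn.
rewrite -!val_eqE /= lk => ik il; rewrite !nth_cat uk.
have [//|ki] := ltnP i' k; have -> : (i' - k)%N = (i' - k.+2).+2 by lia.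
by [].
Qed.

Lemma adm_step_admissible a b : size a = n -> adm_step a b ->
  admissible_step (ffun_of_seq F n a) (ffun_of_seq F n b).
Proof.
move=> an [u [x [y [v [def_a def_b yx1 yx2]]]]].
have ln : ((size u).+1 < n)%N by rewrite -an def_a size_cat /=; lia.
exists (Ordinal (ltnW ln)), (Ordinal ln).
have ak : ffun_of_seq F n a (Ordinal (ltnW ln)) = x%:~R.
  by rewrite ffunE def_a nth_cat ltnn subnn.
have al : ffun_of_seq F n a (Ordinal ln) = y%:~R.
  by rewrite ffunE def_a nth_cat (ltnNge _.+1) leqnSn subSnn.
split=> //.
- by rewrite ak al -[1]/(1%:~R) -rmorphD => /intr_inj/eqP; apply/negP.
- by rewrite ak al -[1]/(1%:~R) -rmorphB => /intr_inj/eqP; apply/negP.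
apply/ffunP => i'; rewrite !ffunE def_b; case: tpermP => [->|->|/eqP + /eqP].
- by rewrite def_a /= !nth_cat ltnn subnn (ltnNge _.+1) leqnSn subSnn.
- by rewrite def_a /= !nth_cat ltnn subnn (ltnNge _.+1) leqnSn subSnn.
rewrite -!val_eqE /= => ik il; congr (_ %:~R); rewrite def_a !nth_cat.
by have [//|ki] := ltnP i' (size u); have -> : (i' - size u)%N = (i' - (size u).+2).+2 by lia.
Qed.

Lemma admissible_equivP a b : size a = n -> size b = n ->
  admissible_equiv (ffun_of_seq F n a) (ffun_of_seq F n b) <-> adm_equiv a b.
Proof.
move=> an bn; split=> [ab|]; last first.
  move=> ab; elim: ab an {bn} => [c d cd cn|c _|c d e cd IHcd de IHde cn].
  - exact/rt_step/adm_step_admissible.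
  - exact: rt_refl.
  apply: rt_trans (IHcd cn) (IHde _).
  by rewrite -(perm_size (adm_equiv_perm cd)).
(* The intermediate vectors of the chain are a priori only vectors over [F], so an integer sequence
   is carried along. *)
suff [d bd ad] : exists2 d, ffun_of_seq F n b = ffun_of_seq F n d & adm_equiv a d.
  suff -> : b = d by [].
  by apply: ffun_of_seq_inj; rewrite // -(perm_size (adm_equiv_perm ad)).
have [c ac] : exists c, c = ffun_of_seq F n a by exists (ffun_of_seq F n a).
rewrite -ac in ab; move: (ffun_of_seq F n b) ab => d cd.
elim: cd a an ac => [{}c {}d cd|{}c|{}c e {}d _ IHce _ IHed] a' an' ac'.
- have [|b' -> a'b'] := @admissible_step_seq a' d an'; first by rewrite -ac'.
  by exists b' => //; apply: rt_step.
- by exists a' => //; apply: rt_refl.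
have [e' ee' ae'] := IHce a' an' ac'.
have [|d' dd' ed'] := IHed e' _ ee'; first by rewrite -(perm_size (adm_equiv_perm ae')).
by exists d' => //; apply: rt_trans ae' ed'.
Qed.

End ContLattice.

(** * The Gelfand-Tsetlin algebra *)

Lemma gring_op_intertwine (F : fieldType) (gT : finGroupType) (G : {group gT}) m1 m2
    (r1 : mx_representation F G m1) (r2 : mx_representation F G m2) X A :
  (forall g, g \in G -> r1 g *m X = X *m r2 g) ->
  (A \in group_ring F G)%MS -> gring_op r1 A *m X = X *m gring_op r2 A.
Proof.
move=> rX /envelop_mxP[c ->].
rewrite [gring_op r1 _]linear_sum [gring_op r2 _]linear_sum mulmx_suml mulmx_sumr.
apply: eq_bigr => g Gg /=; rewrite [gring_op r1 _]linearZ [gring_op r2 _]linearZ /=.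
by rewrite !gring_opG // -scalemxAl rX // -scalemxAr.
Qed.

(* By Maschke's theorem the regular representation is a sum of irreducible ones. *)
Lemma gring_op_faithful (F : fieldType) (gT : finGroupType) (G : {group gT}) A :
  ([pchar F]^'.-group G)%g -> (A \in group_ring F G)%MS ->
  (forall m (rG : mx_representation F G m), mx_irreducible rG -> gring_op rG A = 0) ->
  A = 0.
Proof.
move=> F'G GA A0; pose aG := regular_repr F G.
have simple0 M : mxsimple aG M -> M *m A = 0.
  move=> simM; have [modM _ _] := simM.
  have irrM : mx_irreducible (submod_repr modM) by apply/submod_mx_irr.
  apply/eqP; rewrite -submx0 -(eqmxMr A (val_submod1 M)).
  rewrite -(gring_op_id GA).
  rewrite -(@gring_op_intertwine _ _ _ _ _ (submod_repr modM)) ?A0 ?mul0mx ?sub0mx //.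
  by move=> g Gg; rewrite -(val_submodJ modM) // mul1mx [RHS]val_submodE.
apply/eqP; have := mx_reducible_semisimple (mxmodule1 aG) (mx_Maschke_pchar aG F'G).
apply=> -[I U W simU defW _]; rewrite -[A]mul1mx -submx0 -(eqmxMr A defW).
rewrite sumsmxMr; apply/sumsmx_subP => i' _.
by rewrite simple0.
Qed.

Section GelfandTsetlin.

Variables (F : numClosedFieldType) (n : nat).
Local Notation aG := (regular_repr F [set: 'S_n]).

Lemma jm_opE m (rG : mx_representation F [set: 'S_n] m) (k : 'I_n) :
  jm_op rG k = \sum_(j < n | (j < k)%N) rG (tperm j k).
Proof.
case: k => k; elim: k => [|k IHk] kn; first by rewrite big_pred0.
have k'n : (k < n)%N := ltnW kn.
rewrite /jm_op /= -/(jm_op rG k) (IHk k'n).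
have adjE : adjtp n k = tperm (Ordinal k'n) (Ordinal kn).
  exact: (@adjtpE n (Ordinal k'n) (Ordinal kn) erefl).
rewrite [RHS](bigD1 (Ordinal k'n)) //= adjE addrC; congr (_ + _).
rewrite mulmx_sumr mulmx_suml; apply: eq_big => [j|j jk].
  by rewrite ltnS leq_eqVlt -val_eqE /=; lia.
rewrite -!repr_mxM ?inE //.
rewrite -{1}(tpermV (Ordinal k'n)) -mulgA -conjgE tpermJ tpermL tpermD //.
  by rewrite -val_eqE /=; lia.
by rewrite -val_eqE /=; lia.
Qed.

Lemma gring_op_YJM m (rG : mx_representation F [set: 'S_n] m) (k : 'I_n) :
  gring_op rG (YJM F k) = jm_op rG k.
Proof.
rewrite jm_opE linear_sum; apply: eq_bigr => j _.
by rewrite /= gring_opG ?inE.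
Qed.

Lemma has_weightP (V : irrep F n) v a :
  has_weight v (ffun_of_seq F n a) <-> weighted V v (seq_weight F a).
Proof.
split=> [va k kn|va k].
  by have := va (Ordinal kn); rewrite gring_op_YJM ffunE.
by rewrite gring_op_YJM ffunE va.
Qed.

Lemma YJM_gring (k : 'I_n) : (YJM F k \in group_ring F [set: 'S_n])%MS.
Proof.
rewrite linear_sum summx_sub // => j _; by apply: envelop_mx_id; rewrite inE.
Qed.

Lemma sub_group_ringP l A : reflect
  (exists c, A = \sum_(g in sub_sym n l) c g *: aG g) (A \in sub_group_ring F n l)%MS.
Proof.
exact: (@envelop_mxP _ _ _ _ (subg_repr aG (finset.subsetT (sub_sym n l))) A).
Qed.

Lemma mem_sub_group_ring l g : g \in sub_sym n l -> (aG g \in sub_group_ring F n l)%MS.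
Proof.
exact: (@envelop_mx_id _ _ _ _ (subg_repr aG (finset.subsetT (sub_sym n l)))).
Qed.

Lemma mem_sub_sym l (g : 'S_n) (x : 'I_n) : g \in sub_sym n l ->
  (l <= x)%N -> g x = x.
Proof.
rewrite inE => gS ix; apply: (out_perm gS); by rewrite inE -leqNgt.
Qed.

Lemma sub_sym_lt l (g : 'S_n) (x : 'I_n) m : g \in sub_sym n l -> (l <= m)%N ->
  (g x < m)%N = (x < m)%N.
Proof.
move=> gS im; have [xi|xi] := ltnP x l; last by rewrite (mem_sub_sym gS).
have gS' := gS; rewrite inE in gS'; have := perm_closed x gS'; rewrite !inE xi => gxi.
by rewrite (leq_trans gxi im) (leq_trans xi im).
Qed.

Lemma tperm_sub_sym l (x y : 'I_n) : (x < l)%N -> (y < l)%N -> tperm x y \in sub_sym n l.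
Proof.
move=> xi yi; rewrite inE; apply/fintype.subsetP => z; rewrite !inE.
by case: tpermP => [->|->|]; rewrite ?eqxx.
Qed.

Lemma YJM_sub l (k : 'I_n) : (k < l)%N -> (YJM F k \in sub_group_ring F n l)%MS.
Proof.
move=> ki; rewrite linear_sum summx_sub // => j jk.
by apply: mem_sub_group_ring; apply: tperm_sub_sym; rewrite // (ltn_trans jk).
Qed.

Lemma YJM_perm_comm (k : 'I_n) g : g \in sub_sym n k -> aG g *m YJM F k = YJM F k *m aG g.
Proof.
move=> gS; rewrite mulmx_sumr mulmx_suml (reindex_inj (@perm_inj _ g)) /=.
apply: eq_big => [j|j _]; first by rewrite (sub_sym_lt _ gS).
rewrite -!repr_mxM ?inE //; congr (aG _).
by rewrite -{1}(mem_sub_sym gS (leqnn k)) -tpermJ conjgE mulgA mulgV mul1g.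
Qed.

Lemma sub_sym_sub l m : (l <= m)%N -> {subset sub_sym n l <= sub_sym n m}.
Proof.
move=> im g; rewrite !inE => /fintype.subsetP gS; apply/fintype.subsetP => x /gS.
by rewrite !inE => /leq_trans; apply.
Qed.

(** A central element of the group ring of S_l commutes with [YJM F k] for k < l, which lies in that
    ring, and for l <= k because conjugation by S_k, which contains S_l, permutes the terms of
    [YJM F k]. *)
Lemma GZ_comm A : GZ A -> (A \in group_ring F [set: 'S_n])%MS /\
  forall k : 'I_n, A *m YJM F k = YJM F k *m A.
Proof.
elim=> [l {}A _ /center_mxP[AS AC]||c {}A B _ [AR AC] _ [BR BC]|{}A B _ [AR AC] _ [BR BC]].
- have /sub_group_ringP[c def_A] := AS; split=> [|k].
    rewrite def_A linear_sum summx_sub // => g _; rewrite linearZ scalemx_sub //.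
    by apply: envelop_mx_id; rewrite inE.
  have [ki|ik] := ltnP k l; first by rewrite AC ?YJM_sub.
  rewrite def_A [LHS]mulmx_suml [RHS]mulmx_sumr; apply: eq_bigr => g gS.
  by rewrite -scalemxAl -scalemxAr YJM_perm_comm //; apply: sub_sym_sub gS.
- split=> [|k]; last by rewrite mulmx1 mul1mx.
  rewrite -(repr_mx1 aG); by apply: envelop_mx_id; rewrite inE.
- split=> [|k]; first by rewrite linearP addmx_sub ?scalemx_sub.
  by rewrite mulmxDl mulmxDr -scalemxAl -scalemxAr AC BC.
split=> [|k]; first exact: envelop_mxM.
by rewrite -mulmxA BC !mulmxA AC.
Qed.

Lemma GZ0 : GZ (0 : 'M[F]_#|[set: 'S_n]|).
Proof. by rewrite -(addNr 1%:M) -scaleN1r; apply: GZ_lin; apply: GZ_one. Qed.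

Lemma GZ_add A B : GZ A -> GZ B -> GZ (A + B : 'M[F]_#|[set: 'S_n]|).
Proof. by move=> GA GB; rewrite -[A]scale1r; apply: GZ_lin. Qed.

Lemma GZ_scale c A : GZ A -> GZ (c *: A : 'M[F]_#|[set: 'S_n]|).
Proof. by move=> GA; rewrite -[_ *: _]addr0; apply: GZ_lin => //; apply: GZ0. Qed.

(* Twice the sum of the transpositions of S_m, plus m: summing over all pairs
   makes the conjugation invariance a plain reindexing. *)
Definition tperm_sum m : 'M[F]_#|[set: 'S_n]| :=
  \sum_(x < n | (x < m)%N) \sum_(y < n | (y < m)%N) aG (tperm x y).

Lemma GZ_tperm_sum m : (m <= n)%N -> GZ (tperm_sum m).
Proof.
have [->|m0] := posnP m; first by rewrite /tperm_sum big_pred0 //; move=> _; apply: GZ0.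
move=> mn; apply: (@GZ_center _ _ m); first by rewrite m0.
apply/center_mxP; split=> [|B /sub_group_ringP[c ->]].
  rewrite linear_sum summx_sub // => x xm; rewrite linear_sum summx_sub // => y ym.
  exact/mem_sub_group_ring/tperm_sub_sym.
rewrite [LHS]mulmx_suml [RHS]mulmx_sumr; apply: eq_bigr => g gS.
rewrite -scalemxAl -scalemxAr; congr (_ *: _).
rewrite mulmx_sumr mulmx_suml (reindex_inj (@perm_inj _ g)) /=.
apply: eq_big => [x|x _]; first by rewrite (sub_sym_lt _ gS).
rewrite mulmx_sumr mulmx_suml (reindex_inj (@perm_inj _ g)) /=.
apply: eq_big => [y|y _]; first by rewrite (sub_sym_lt _ gS).
rewrite -!repr_mxM ?inE //; congr (aG _).
by rewrite -tpermJ conjgE mulgA mulgV mul1g.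
Qed.

(** The pair x = y = k gives the identity, and the pairs with exactly one entry k give [YJM F k]
    twice. Central elements of two successive group algebras thus produce X_(k+1). *)
Lemma tperm_sumS (k : 'I_n) : tperm_sum k.+1 = tperm_sum k + 2 *: YJM F k + 1%:M.
Proof.
have split_last (f : 'I_n -> 'M[F]_#|[set: 'S_n]|) :
    \sum_(x < n | (x < k.+1)%N) f x = f k + \sum_(x < n | (x < k)%N) f x.
  rewrite (bigD1 k) //=; congr (_ + _); apply: eq_bigl => x.
  by rewrite ltnS -val_eqE /=; lia.
rewrite /tperm_sum split_last split_last tperm1 repr_mx1.
under [X in _ + X]eq_bigr => x _ do rewrite split_last.
rewrite big_split /= -/(YJM F k).
under eq_bigr => x _ do rewrite tpermC.
rewrite -/(YJM F k) scaler_nat mulr2n; move: (YJM F k) 1%:M => Y I.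
by rewrite -addrA [LHS]addrC; congr (_ + _); rewrite addrA addrC.
Qed.

Lemma GZ_YJM (k : 'I_n) : GZ (YJM F k).
Proof.
have -> : YJM F k = 2^-1 *: (tperm_sum k.+1 + (-1) *: tperm_sum k + (-1) *: 1%:M).
  rewrite tperm_sumS !scaleN1r addrAC addrK addrC addrA addNr add0r.
  by rewrite scalerA mulVf ?scale1r // pnatr_eq0.
apply/GZ_scale/GZ_add; last exact/GZ_scale/GZ_one.
by apply: GZ_add; [apply: GZ_tperm_sum | apply/GZ_scale/GZ_tperm_sum/ltnW].
Qed.

End GelfandTsetlin.

(** * The characters of GZ(n) *)

Section GelfandTsetlinSpectrum.

Variables (F : numClosedFieldType) (n : nat).

Lemma weighted_gring_op m (rG : mx_representation F [set: 'S_n] m) v c A :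
  GZ A -> weighted rG v c -> weighted rG (v *m gring_op rG A) c.
Proof.
move=> /GZ_comm[AR AC] vc k kn; have E := gring_op_YJM rG (Ordinal kn).
rewrite -E -mulmxA -gring_opM ?YJM_gring // AC gring_opM // E mulmxA vc //.
by rewrite scalemxAl.
Qed.

(** The diagonal matrix coefficient at [b] in the module of its own shape. For [A] in GZ(n) and a
    tableau [b] it is the eigenvalue of [A] there, obtained without a choice. *)
Definition gz_val (b : seq int) (A : 'M[F]_#|[set: 'S_n]|) : F :=
  (tvec F n b b *m gring_op (orth_repr F n b) A *m (tvec F n b b)^T) 0 0.

Lemma tvec_weighted a b : weighted (orth_repr F n a) (tvec F n a b) (seq_weight F b).
Proof.
move=> k kn; rewrite -(tvec_jm F a b kn) -[jm_op _ _]mul1mx -[jm_mx _ _ in RHS]mulmx1.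
congr (_ *m _); apply/esym/(jm_intertwine (n := n)) => // j jn.
by rewrite mul1mx mulmx1 orth_repr_adj.
Qed.

Lemma tvec_dot b : lattice b -> size b = n ->
  (tvec F n b b *m (tvec F n b b)^T) 0 0 = 1.
Proof.
move=> bP bn; have [j def_b] := mem_tableaux_nth (mem_tableaux_self bP bn).
have -> : tvec F n b b = delta_mx 0 j by rewrite -tvec_nth -def_b.
by rewrite trmx_delta mul_delta_mx mxE !eqxx.
Qed.

Lemma gz_val_eigen m (rG : mx_representation F [set: 'S_n] m) a b v A :
  mx_rsim (orth_repr F n a) rG -> b \in tableaux n a ->
  weighted rG v (seq_weight F b) -> GZ A ->
  v *m gring_op rG A = gz_val b A *: v.
Proof.
move=> rGa; rewrite mem_tableaux => /and3P[/eqP bn bP ab] vb GA.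
have bL := mem_tableaux_self bP bn; have t0 := tvec_neq0 F bL.
have rGb := mx_rsim_trans (mx_rsim_sym (orth_rsim_perm F n ab)) rGa.
have [X _ Xfree rX] := rGb.
have tX0 : tvec F n b b *m X != 0.
  by rewrite -(mul0mx _ X) (inj_eq (row_free_inj Xfree)).
have tXA : tvec F n b b *m X *m gring_op rG A = gz_val b A *: (tvec F n b b *m X).
  (* [A] commutes with the X_k, so it preserves the line of weight [b]. *)
  have [x xE] := weighted_line (mx_rsim_refl _) t0 bn (@tvec_weighted b b)
    (weighted_gring_op GA (@tvec_weighted b b)).
  have -> : gz_val b A = x by rewrite /gz_val xE -scalemxAl mxE tvec_dot ?mulr1.
  rewrite -mulmxA -(gring_op_intertwine rX); last by have [] := GZ_comm GA.
  by rewrite mulmxA xE -scalemxAl.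
have tXb : weighted rG (tvec F n b b *m X) (seq_weight F b).
  move=> k kn; rewrite -mulmxA -(@jm_intertwine _ _ _ n (adj_mx F n b)) //.
    by rewrite mulmxA tvec_jm // scalemxAl.
  by move=> j jn; rewrite -orth_repr_adj // rX ?inE.
have [x ->] := weighted_line rGa tX0 bn tXb vb.
by rewrite -scalemxAl tXA !scalerA mulrC.
Qed.

Section Values.

Variable b : seq int.
Hypotheses (bP : lattice b) (bn : size b = n).

Lemma gz_val_tvec A : GZ A ->
  tvec F n b b *m gring_op (orth_repr F n b) A = gz_val b A *: tvec F n b b.
Proof.
apply: gz_val_eigen (mx_rsim_refl _) (mem_tableaux_self bP bn) _.
exact: tvec_weighted.
Qed.

Lemma gz_val_unique A x : tvec F n b b *m gring_op (orth_repr F n b) A = x *: tvec F n b b ->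
  gz_val b A = x.
Proof. by move=> xE; rewrite /gz_val xE -scalemxAl mxE tvec_dot ?mulr1. Qed.

Lemma gz_val1 : gz_val b 1%:M = 1.
Proof. by apply: gz_val_unique; rewrite gring_op1 mulmx1 scale1r. Qed.

Lemma gz_val_lin c A B : GZ A -> GZ B -> gz_val b (c *: A + B) = c * gz_val b A + gz_val b B.
Proof.
move=> GA GB; apply: gz_val_unique.
by rewrite linearP mulmxDr -scalemxAr !gz_val_tvec // scalerDl scalerA.
Qed.

Lemma gz_valM A B : GZ A -> GZ B -> gz_val b (A *m B) = gz_val b A * gz_val b B.
Proof.
move=> GA GB; apply: gz_val_unique; have [BR _] := GZ_comm GB.
by rewrite gring_opM // mulmxA !(gz_val_tvec, =^~ scalemxAl) // scalerA.
Qed.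

Lemma gz_val_YJM (k : 'I_n) : gz_val b (YJM F k) = (nth 0 b k)%:~R.
Proof. by apply: gz_val_unique; rewrite gring_op_YJM tvec_weighted. Qed.

End Values.

Lemma GZ_eq0 A : GZ A ->
  (forall b, lattice b -> size b = n -> gz_val b A = 0) -> A = 0.
Proof.
move=> GA A0; have [AR _] := GZ_comm GA.
apply: (gring_op_faithful (@Sn_pcharF F n) AR) => m rG /irr_orth[a [aP an rGa]].
apply: (weighted_span rGa) => v b bL v0 vb.
rewrite (gz_val_eigen rGa bL vb GA) A0 ?scale0r //.
  by move: bL; rewrite mem_tableaux => /and3P[].
by move: bL; rewrite mem_tableaux => /and3P[/eqP].
Qed.

Definition gz_char (b : seq int) (A : 'M[F]_#|[set: 'S_n]|) : F :=
  if `[< GZ A >] then gz_val b A else 0.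

Lemma gz_charE b A : GZ A -> gz_char b A = gz_val b A.
Proof. by rewrite /gz_char => /asboolT ->. Qed.

Lemma gz_char_spectrum b : lattice b -> size b = n -> GZ_spectrum F n (gz_char b).
Proof.
move=> bP bn; split=> [|c A B GA GB|A B GA GB|A nGA].
- by rewrite gz_charE ?gz_val1 //; apply: GZ_one.
- by rewrite !gz_charE ?gz_val_lin //; apply: GZ_lin.
- by rewrite !gz_charE ?gz_valM //; apply: GZ_mul.
by rewrite /gz_char asboolF.
Qed.

(* If [chi] differs from each [gz_char b] at some [A_ b], then the product of the
   elements [A_ b - gz_val b (A_ b)] vanishes on all the weight vectors, hence is 0,
   while its image under [chi] is not 0. *)
Lemma gz_char_surj chi : GZ_spectrum F n chi ->
  exists b, [/\ lattice b, size b = n & chi = gz_char b].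
Proof.
move=> [chi1 chi_lin chiM chi0]; apply: contrapT => no_b.
have A_P b : exists A, lattice b -> size b = n -> GZ A /\ chi A <> gz_val b A.
  have [[bP bn]|nb] := pselect (lattice b /\ size b = n); last first.
    by exists 0 => bP bn; case: nb.
  apply: contrapT => /forallNP nA; apply: no_b; exists b; split=> //.
  apply/funext => A; have [GA|nGA] := pselect (GZ A); last first.
    by rewrite /gz_char asboolF // chi0.
  rewrite gz_charE //; apply: contrapT => chiA.
  by apply: (nA A) => _ _; split.
have [A_ {}A_P] := choice A_P.
pose B b := (- gz_val b (A_ b)) *: 1%:M + A_ b.
have BP b : lattice b -> size b = n ->
    [/\ GZ (B b), chi (B b) != 0 & gz_val b (B b) = 0].
  move=> bP bn; have [GA chiA] := A_P b bP bn; have G1 := GZ_one F n; split.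
  - exact: GZ_lin.
  - by rewrite chi_lin // chi1 mulr1 addrC subr_eq0; apply/eqP.
  by rewrite gz_val_lin // gz_val1 // mulr1 addNr.
pose P s := foldr (fun b M => B b *m M) 1%:M s.
have PP s : {in s, forall b, lattice b /\ size b = n} ->
    [/\ GZ (P s), chi (P s) != 0 & {in s, forall b, gz_val b (P s) = 0}].
  elim: s => [_|b s IHs sP] /=; first by split; rewrite ?chi1 ?oner_eq0 //; apply: GZ_one.
  have [c cs|GP chiP P0] := IHs; first by apply: sP; rewrite inE cs orbT.
  have [bP bn] := sP b (mem_head _ _); have [GB chiB B0] := BP b bP bn.
  split; [exact: GZ_mul|by rewrite chiM // mulf_neq0|move=> c].
  rewrite inE => /predU1P[->|cs]; first by rewrite gz_valM // B0 mul0r.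
  have [cP cn] := sP c (@mem_behead _ (b :: s) c cs).
  by rewrite gz_valM // P0 // mulr0.
have [b|GP chiP P0] := PP (lattices n n); first by rewrite mem_lattices // => /andP[/eqP].
case/eqP: chiP; rewrite (GZ_eq0 GP) => [|b bP bn].
  have -> : 0 = (-1) *: 1%:M + 1%:M :> 'M[F]_#|[set: 'S_n]| by rewrite scaleN1r addNr.
  by rewrite chi_lin ?chi1 ?mulr1 ?addNr //; apply: GZ_one.
by apply: P0; rewrite mem_lattices // bn eqxx.
Qed.

End GelfandTsetlinSpectrum.

(** * The branching graph *)

Section YoungBranching.

Variable F : numClosedFieldType.
Local Open Scope quotient_scope.

Lemma class_repr_pi n (V : irrep F n) :
  mx_rsim V (class_repr (\pi_{eq_quot (@irrep_iso F n)} V)).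
Proof.
apply: mx_rsim_sym.
suff /asboolP : irrep_iso (class_repr (\pi_{eq_quot (@irrep_iso F n)} V)) V by [].
by apply/eqmodP; rewrite /class_repr reprK.
Qed.

Lemma pi_class_repr n (V : irrep F n) (la : irrep_class F n) :
  mx_rsim V (class_repr la) -> \pi_{eq_quot (@irrep_iso F n)} V = la.
Proof.
move=> Vla; suff: irrep_iso V (class_repr la) by move/eqmodP ->; apply: reprK.
exact/asboolP.
Qed.

Definition diagram_word n (D : diagram n) : seq int :=
  s2val (cid2 (diagram_lattice (@diagramP n D))).

Lemma diagram_wordP n (D : diagram n) :
  [/\ lattice (diagram_word D), size (diagram_word D) = n &
      perm_eq (diagram_word D) (contents D)].
Proof.
rewrite /diagram_word; case: cid2 => a /= aP aD; split=> //.
by rewrite (perm_size aD) size_contents card_diagram.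
Qed.

Lemma diagram_irrep_subproof n (D : diagram n) :
  mx_irreducible (orth_repr F n (diagram_word D)).
Proof. by have [aP an _] := diagram_wordP D; apply: orth_repr_irr. Qed.

Definition diagram_class n (D : young_graph n) : branching_graph F n :=
  \pi_{eq_quot (@irrep_iso F n)} (Irrep (diagram_irrep_subproof (D : diagram n))).

Lemma diagram_class_rsim n (D : diagram n) a : perm_eq a (contents D) ->
  mx_rsim (orth_repr F n a) (class_repr (diagram_class D : irrep_class F n)).
Proof.
move=> aD; have [_ _ wD] := diagram_wordP D.
apply: mx_rsim_trans (class_repr_pi _); apply: orth_rsim_perm.
by rewrite (permPr wD).
Qed.

Lemma diagram_class_inj n : injective (@diagram_class n).
Proof.
move=> D E DE; have [aP an aD] := diagram_wordP (D : diagram n).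
have [bP bn bE] := diagram_wordP (E : diagram n).
have := diagram_class_rsim aD; rewrite DE => aE.
apply: diagram_inj; apply: diagram_eq; try exact: diagramP.
rewrite -(permPl aD) -(permPr bE) perm_sym; apply: (orth_rsim_eq (F := F) aP an).
exact: mx_rsim_trans aE (mx_rsim_sym (diagram_class_rsim bE)).
Qed.

Lemma diagram_class_surj n (la : branching_graph F n) : exists D, diagram_class D = la.
Proof.
have [a [aP an aV]] := irr_orth (irrepP (class_repr (la : irrep_class F n))).
have [T def_a] := lattice_path aP an; exists (T ord_max).
apply: pi_class_repr; apply: mx_rsim_trans aV; apply: orth_rsim_perm.
have [_ _ wD] := diagram_wordP (T ord_max : diagram n).
by rewrite (permPl wD) perm_sym -def_a path_word_contents.
Qed.

Lemma diagram_class_bij n : bijective (@diagram_class n).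
Proof.
have [g gK] := choice (@diagram_class_surj n).
by exists g => // D; apply: diagram_class_inj; rewrite gK.
Qed.

Lemma diagram_class_edges n (mu : young_graph n) (la : young_graph n.+1) :
  edges (diagram_class mu) (diagram_class la) = edges mu la.
Proof.
have [aP an aD] := diagram_wordP (mu : diagram n).
have [bP bn bE] := diagram_wordP (la : diagram n.+1).
have aV := diagram_class_rsim aD; have bW := diagram_class_rsim bE.
have edge1 : (edges mu la <= 1)%N by apply: leq_b1.
have [[c acb]|no_c] := pselect (exists c, perm_eq (rcons (diagram_word mu) c) (diagram_word la)).
  rewrite [LHS](restr_hom_dim1 aP an aV bP bW acb).
  suff: (0 < edges mu la)%N by move: edge1; case: (edges mu la) => [|[]].
  apply: (@young_edge_contents _ _ _ c).
  by rewrite -(permPr bE) -(permPr acb) perm_sym perm_rcons perm_cons.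
rewrite [LHS](restr_hom_dim0 aP an aV bW) => [|c]; last first.
  by apply/negP => acb; apply: no_c; exists c.
apply/esym/eqP; rewrite -leqn0 leqNgt; apply/negP => /skew_box_contents la_mu.
apply: no_c; exists (content (skew_box (mu : diagram n) (la : diagram n.+1))).
by rewrite perm_rcons (permPr bE) (permPr la_mu) perm_cons.
Qed.

Lemma content_vector_word n (T : gpath young_graph n) :
  content_vector F T = ffun_of_seq F n (path_word T).
Proof. by apply/ffunP => k; rewrite content_vectorE ffunE. Qed.

Lemma content_vector_inj n : injective (@content_vector F n).
Proof.
move=> T T'; rewrite !content_vector_word => /ffun_of_seq_inj TT'.
by apply: path_word_inj; apply: TT'; rewrite size_path_word.
Qed.

Definition over n (P : gpath (branching_graph F) n) (T : gpath young_graph n) :=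
  forall k : 'I_n.+1, P k = diagram_class (T k).

Lemma over_rsim n (P : gpath (branching_graph F) n) T (k : 'I_n.+1) : over P T ->
  mx_rsim (orth_repr F k (take k (path_word T))) (class_repr (P k : irrep_class F k)).
Proof.
move=> PT; rewrite PT; apply: diagram_class_rsim.
by have [] := path_word_take T k.
Qed.

Lemma exists_over_path n (P : gpath (branching_graph F) n) : exists T, over P T.
Proof.
have D_P (k : 'I_n.+1) : {D | diagram_class D = P k}.
  by apply: cid; apply: diagram_class_surj.
pose D k := sval (D_P k); have DK k : diagram_class (D k) = P k := svalP (D_P k).
have De (k : 'I_n) : (0 < edges (D (edge_src k)) (D (edge_tgt k)))%N.
  have := gpath_edge P k; rewrite -(DK (edge_src k)) -(DK (edge_tgt k)).
  by rewrite (@diagram_class_edges k).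
by exists (GPath De) => k; rewrite DK.
Qed.

Lemma exists_over_word n (T : gpath young_graph n) : exists P, over P T.
Proof.
have De (k : 'I_n) : (0 < edges (diagram_class (T (edge_src k))) (diagram_class (T (edge_tgt k))))%N.
  by rewrite diagram_class_edges; apply: (gpath_edge T k).
by exists (@GPath (branching_graph F) n (fun k => diagram_class (T k)) De).
Qed.

(** * Young vectors along a path *)

Section OverPath.

Variables (n : nat) (P : gpath (branching_graph F) n) (T : gpath young_graph n).
Hypothesis PT : over P T.

Local Notation word := (path_word T).
Local Notation rep k := (class_repr (P k : irrep_class F k)).

Lemma take_edge_tgt (k : 'I_n) :
  take (edge_tgt k) word = rcons (take (edge_src k) word) (nth 0 word k).
Proof. by rewrite /= (take_nth 0) ?size_path_word. Qed.

Lemma size_take_word (k : 'I_n.+1) : size (take k word) = k.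
Proof. by rewrite size_takel // size_path_word -ltnS. Qed.

(** The vertex of the path at the next level fixes the multiset of eigenvalues, hence the one that
    [restricted_weight] leaves open. *)
Lemma restr_word_weight (k : 'I_n) B (w : 'rV_(irrep_dim (rep (edge_src k)))) :
  B \in restr_hom (rep (edge_src k)) (rep (edge_tgt k)) -> B != 0 ->
  w != 0 -> weighted (rep (edge_src k)) w (seq_weight F (take (edge_src k) word)) ->
  w *m B != 0 /\
  weighted (rep (edge_tgt k)) (w *m B) (seq_weight F (take (edge_tgt k) word)).
Proof.
move=> BP B0 w0 wk; have wB0 : w *m B != 0.
  by apply: contraNneq B0 => /(restr_hom_eq0 BP w0) ->.
split=> //.
have [c cP] := restricted_weight (over_rsim (edge_tgt k) PT) wB0 (size_take_word (edge_src k))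
  (restr_hom_weight BP wk).
by rewrite take_edge_tgt in cP *; rewrite (perm_rcons_last cP).
Qed.

Lemma young_vector_weight v : young_vector P v ->
  v != 0 /\ has_weight v (content_vector F T).
Proof.
case=> w [w0 <- wB]; rewrite content_vector_word.
suff wP (k : 'I_n.+1) : w k != 0 /\
    weighted (rep k) (w k) (seq_weight F (take k word)).
  have [wn0 wn] := wP ord_max; split=> //; apply/has_weightP.
  by move: wn; rewrite take_oversize // size_path_word.
have [m] : exists m, k = m :> nat by exists k.
elim: m k => [|m IHm] k km.
  have -> : k = ord0 by apply: val_inj.
  by split=> [|l]; [apply: w0 | rewrite ltn0].
have mn : (m < n)%N by rewrite -ltnS -km ltn_ord.
have -> : k = edge_tgt (Ordinal mn) by apply: val_inj.
have [wm0 wm] := IHm (edge_src (Ordinal mn)) erefl.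
have [B [BP B0 ->]] := wB (Ordinal mn).
exact: restr_word_weight.
Qed.

Lemma exists_young_vector : exists v, young_vector P v.
Proof.
have wP (k : 'I_n.+1) : {w | w != 0 /\ weighted (rep k) w (seq_weight F (take k word))}.
  apply: cid; have [w w0 wk] := exists_weighted (over_rsim k PT)
    (mem_tableaux_self (lattice_take k (path_word_lattice T)) (size_take_word k)).
  by exists w.
pose w k := sval (wP k); have w0 k : w k != 0 := (svalP (wP k)).1.
have wk k := (svalP (wP k)).2; rewrite -/(w _) in wk.
exists (w ord_max), w; split=> [||k]; [exact: w0|by []|].
pose H := restr_hom (rep (edge_src k)) (rep (edge_tgt k)).
have B0 : vpick H != 0 by rewrite vpick0 -dimv_eq0 -lt0n; apply: (gpath_edge P k).
have [wB0 wBk] := restr_word_weight (memv_pick H) B0 (w0 _) (wk _).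
(* The vectors [w k] were chosen independently; weight lines being one-dimensional, the map along
   the edge matches successive ones up to a nonzero scalar, absorbed into the map. *)
have [x wx] : exists x, w (edge_tgt k) = x *: (w (edge_src k) *m vpick H) :=
  weighted_line (over_rsim (edge_tgt k) PT) wB0 (size_take_word _) wBk (wk _).
exists (x *: vpick H); split; first by rewrite rpredZ // memv_pick.
  rewrite scaler_eq0 negb_or B0 andbT; apply: contraNneq (w0 (edge_tgt k)) => x0.
  by rewrite wx x0 scale0r.
by rewrite wx scalemxAr.
Qed.

End OverPath.

Lemma has_weight_eq n (V : irrep F n) (v : 'rV_(irrep_dim V)) a b : v != 0 ->
  has_weight v a -> has_weight v b -> a = b.
Proof.
move=> v0 va vb; apply/ffunP => k; apply/eqP; rewrite -subr_eq0.
have := va k; rewrite vb => /eqP.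
by rewrite eq_sym -subr_eq0 -scalerBl scaler_eq0 (negPf v0) orbF.
Qed.

Lemma SpecP n a : Spec F n a <-> exists T : gpath young_graph n, a = content_vector F T.
Proof.
split=> [[P [v [Pv va]]]|[T ->]].
  have [T PT] := exists_over_path P; exists T.
  by have [v0 vT] := young_vector_weight PT Pv; apply: has_weight_eq va vT.
have [P PT] := exists_over_word T; have [v Pv] := exists_young_vector PT.
by exists P, v; split=> //; have [] := young_vector_weight PT Pv.
Qed.

Lemma same_moduleP n (T T' : gpath young_graph n) :
  same_module (content_vector F T) (content_vector F T') <->
  T ord_max = T' ord_max.
Proof.
(* A nonzero vector has at most one weight, and the weight determines the tableau. *)
have overE P Q S v : over P Q -> young_vector P v -> has_weight v (content_vector F S) -> Q = S.
  move=> PQ Pv vS; have [v0 vQ] := young_vector_weight PQ Pv.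
  exact/content_vector_inj/(has_weight_eq v0 vQ vS).
split=> [[P [Q [PQ [v Pv vT] [w Qw wT']]]]|TT'].
  have [S PS] := exists_over_path P; have [S' QS'] := exists_over_path Q.
  rewrite -(overE _ _ _ _ _ PS Pv vT) -(overE _ _ _ _ _ QS' Qw wT').
  by apply: diagram_class_inj; rewrite -PS -QS'.
have [P PT] := exists_over_word T; have [v Pv] := exists_young_vector PT.
have [Q QT'] := exists_over_word T'; have [w Qw] := exists_young_vector QT'.
exists P, Q; split; first by rewrite PT QT' TT'.
  by exists v => //; have [] := young_vector_weight PT Pv.
by exists w => //; have [] := young_vector_weight QT' Qw.
Qed.

Lemma path_end_eqP n (T T' : gpath young_graph n) :
  T ord_max = T' ord_max <-> adm_equiv (path_word T) (path_word T').
Proof.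
split=> [TT'|/adm_equiv_perm TT'].
  apply: lattice_adm_equiv; try exact: path_word_lattice.
  by rewrite (permPl (path_word_contents T)) TT' perm_sym path_word_contents.
apply: diagram_inj; apply: diagram_eq; try exact: diagramP.
by rewrite -(permPl (path_word_contents T)) (permPl TT') path_word_contents.
Qed.

Lemma Spec_Cont n : Spec F n = Cont F n.
Proof.
apply/seteqP; split=> a.
  move=> /SpecP[T ->]; rewrite content_vector_word.
  by apply: lattice_Cont; rewrite ?path_word_lattice ?size_path_word.
move=> aC; have [b [bn def_a]] := Cont_int aC; apply/SpecP.
rewrite def_a in aC *; have [T <-] := lattice_path (Cont_lattice bn aC) bn.
by exists T; rewrite content_vector_word.
Qed.

Lemma content_vector_bij n :
  set_bij [set: gpath young_graph n]%classic (Spec F n) (@content_vector F n).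
Proof.
split=> [T _|T T' _ _ /content_vector_inj//|a /SpecP[T ->]]; last by exists T.
by apply/SpecP; exists T.
Qed.

Lemma gz_char_YJM n (T : gpath young_graph n) k :
  gz_char (path_word T) (YJM F k) = content_vector F T k.
Proof.
rewrite gz_charE ?gz_val_YJM ?content_vectorE ?size_path_word //; last exact: GZ_YJM.
exact: path_word_lattice.
Qed.

Lemma gz_char_bij n : set_bij [set: gpath young_graph n]%classic (GZ_spectrum F n)
  (fun T => gz_char (F := F) (n := n) (path_word T)).
Proof.
split=> [T _|T T' _ _ TT'|chi /gz_char_surj[b [bP bn ->]]].
- by apply: gz_char_spectrum; rewrite ?path_word_lattice ?size_path_word.
- by apply: content_vector_inj; apply/ffunP => k; rewrite -!gz_char_YJM TT'.
by have [T <-] := lattice_path bP bn; exists T.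
Qed.

End YoungBranching.

Theorem theorem5p8 (R : realType) :
  (exists f : forall n, young_graph n -> branching_graph R[i] n,
     graded_iso f /\
     (forall (n : nat) (T : gpath young_graph n)
             (P : gpath (branching_graph R[i]) n),
        (0 < n)%N -> (forall i : 'I_n.+1, P i = f i (T i)) ->
        forall v, young_vector P v ->
        has_weight v (content_vector R[i] T))) /\
  (forall n : nat, (0 < n)%N ->
     [/\ (exists2 chi,
            set_bij [set: gpath young_graph n]%classic (GZ_spectrum R[i] n) chi &
            forall (T : gpath young_graph n) (i : 'I_n),
              chi T (YJM R[i] i) = content_vector R[i] T i),
         set_bij [set: gpath young_graph n]%classic (Spec R[i] n)
           (@content_vector R[i] n),
         Spec R[i] n = Cont R[i] n &
         forall a b, Spec R[i] n a -> Spec R[i] n b ->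
           (same_module a b <-> admissible_equiv a b)]).
Proof.
split=> [|n _].
  exists (@diagram_class R[i]); split=> [|n T P _ PT v Pv].
    split=> [n|n mu la]; [exact: diagram_class_bij | exact: diagram_class_edges].
  by have [] := young_vector_weight PT Pv.
split.
- exists (fun T => gz_char (F := R[i]) (n := n) (path_word T)); first exact: gz_char_bij.
  exact: gz_char_YJM.
- exact: content_vector_bij.
- exact: Spec_Cont.
move=> a b /SpecP[T ->] /SpecP[T' ->]; rewrite !content_vector_word.
rewrite admissible_equivP ?size_path_word // -path_end_eqP -!content_vector_word.
exact: same_moduleP.
Qed.
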